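(* Let $\Lambda$ be an artin algebra. If $\dim(\mathrm{mod}\,\Lambda)\leq 1$, then $\mathrm{fin.dim}\,\Lambda<\infty$.
   Context: $\mathrm{mod}\,\Lambda$ is the category of finitely generated right $\Lambda$-modules. The finitistic dimension is $\mathrm{fin.dim}\,\Lambda:=\sup\{\mathrm{pd}\,M\mid M\in\mathrm{mod}\,\Lambda,\ \mathrm{pd}\,M<\infty\}$, where $\mathrm{pd}$ is projective dimension. Let $\mathcal{A}$ be an abelian category. For a class $\mathcal{U}$ of objects, $\mathrm{add}\,\mathcal{U}$ is the full subcategory of direct summands of finite direct sums of objects of $\mathcal{U}$. For subcategories $\mathcal{U}_1,\mathcal{U}_2$, $\mathcal{U}_1\diamond\mathcal{U}_2:=\mathrm{add}\{A\in\mathcal{A}\mid \text{there is an exact sequence } 0\to U_1\to A\to U_2\to 0 \text{ with } U_1\in\mathcal{U}_1, U_2\in\mathcal{U}_2\}$. For $T\in\mathcal{A}$: $\langle T\rangle_0=0$, $\langle T\rangle_1=\mathrm{add}\,T$, $\langle T\rangle_n=\langle T\rangle_1\diamond\langle T\rangle_{n-1}$ for $n\ge 2$. The extension dimension is $\dim\mathcal{A}:=\inf\{n\ge 0\mid \mathcal{A}=\langle T\rangle_{n+1}\text{ for some }T\in\mathcal{A}\}$ (with $\inf\emptyset=+\infty$). *)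

(* Defs.v *)
From HB Require Import structures.
From mathcomp Require Import all_boot all_order all_algebra.
From mathcomp Require Import boolp classical_sets constructive_ereal.

Set Implicit Arguments.
Unset Strict Implicit.
Unset Printing Implicit Defensive.

Import Order.TTheory GRing.Theory Num.Theory.

Local Open Scope classical_set_scope.
Local Open Scope ring_scope.

Definition surjective (A B : Type) (f : A -> B) : Prop :=
  forall y, exists x, f x = y.

Definition zero_module (V : zmodType) : Prop := forall x : V, x = 0.

Definition exact_at (A B C : zmodType) (f : A -> B) (g : B -> C) : Prop :=
  forall y, g y = 0 <-> exists x, f x = y.

Definition finitely_generated (S : pzRingType) (M : lmodType S) : Prop :=
  exists (n : nat) (g : 'I_n -> M),
    forall x, exists c : 'I_n -> S, x = \sum_i c i *: g i.

Definition artinian (R : comNzRingType) : Prop :=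
  forall I : nat -> {pred R^o},
    (forall n, submod_closed (I n)) ->
    (forall n, {subset I n.+1 <= I n}) ->
    exists n, forall m, (n <= m)%N -> I m =i I n.

Definition artin_algebra (R : comNzRingType) (L : algType R) : Prop :=
  artinian R /\ finitely_generated L.

(* Every subset of \bar int = int U {-oo, +oo} has an infimum and a supremum; the
   first argument of infimum (supremum) is its value on the empty set. *)
Definition inf_nat (A : set nat) : \bar int :=
  infimum +oo%E [set (n%:Z)%:E | n in A].

Definition projective (S : pzRingType) (P : lmodType S) : Prop :=
  forall (B C : lmodType S) (g : {linear B -> C}) (f : {linear P -> C}),
    surjective g -> exists h : {linear P -> B}, forall x, g (h x) = f x.

(* ... -> P 2 -> P 1 -> P 0 -> M -> 0, with P i = 0 for i > n *)
Definition has_proj_resolution (S : pzRingType) (M : lmodType S) (n : nat) :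
    Prop :=
  exists (P : nat -> lmodType S) (d : forall i, {linear P i.+1 -> P i})
         (e : {linear P 0 -> M}),
    [/\ forall i, projective (P i),
        forall i, (n < i)%N -> zero_module (P i),
        surjective e,
        exact_at (d 0) e
      & forall i, exact_at (d i.+1) (d i)].

Definition pd (S : pzRingType) (M : lmodType S) : \bar int :=
  inf_nat [set n | has_proj_resolution M n].

(* Objects of mod L: right L-modules are left modules over the converse ring. *)
Record fgmod (L : nzRingType) := FgMod {
  fgmod_sort :> lmodType L^c;
  fgmodP : finitely_generated fgmod_sort
}.

Definition findim (L : nzRingType) : \bar int :=
  supremum -oo%E
    [set d | exists M : fgmod L, (pd M < +oo)%E /\ d = pd M].

(* Classes of objects of mod L are predicates fgmod L -> Prop; the type
   set (fgmod L) is not available for universe reasons. *)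

Definition direct_sum_of (L : nzRingType) (n : nat) (U : 'I_n -> fgmod L)
    (B : fgmod L) : Prop :=
  exists (inj : forall i, {linear U i -> B})
         (proj : forall i, {linear B -> U i}),
    [/\ forall i x, proj i (inj i x) = x,
        forall i j x, i != j -> proj j (inj i x) = 0
      & forall y, y = \sum_i inj i (proj i y)].

Definition direct_summand (L : nzRingType) (A B : fgmod L) : Prop :=
  exists (s : {linear A -> B}) (r : {linear B -> A}), forall x, r (s x) = x.

Definition add_class (L : nzRingType) (U : fgmod L -> Prop) (A : fgmod L) : Prop :=
  exists (n : nat) (V : 'I_n -> fgmod L) (B : fgmod L),
    [/\ forall i, U (V i), direct_sum_of V B & direct_summand A B].

Definition short_exact (L : nzRingType) (A B C : fgmod L)
    (f : {linear A -> B}) (g : {linear B -> C}) : Prop :=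
  [/\ injective f, exact_at f g & surjective g].

Definition diamond (L : nzRingType) (U1 U2 : fgmod L -> Prop) :
    fgmod L -> Prop :=
  add_class (fun A =>
    exists (A1 A2 : fgmod L) (f : {linear A1 -> A}) (g : {linear A -> A2}),
      [/\ U1 A1, U2 A2 & short_exact f g]).

(* layer T n is the class <T>_n *)
Fixpoint layer (L : nzRingType) (T : fgmod L) (n : nat) : fgmod L -> Prop :=
  match n with
  | 0 => fun M => zero_module M
  | 1 => add_class (fun M => M = T)
  | m.+1 => diamond (add_class (fun M => M = T)) (layer T m)
  end.

Definition extdim (L : nzRingType) : \bar int :=
  inf_nat [set n | exists T : fgmod L, forall M, layer T n.+1 M].

(* Main.v *)
From HB Require Import structures.
Require Import Defs.
From mathcomp Require Import all_boot all_order all_algebra.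
From mathcomp Require Import boolp classical_sets constructive_ereal.
From mathcomp Require Import functions.

Set Implicit Arguments.
Unset Strict Implicit.
Unset Printing Implicit Defensive.

Import Order.TTheory GRing.Theory Num.Theory.

Local Open Scope classical_set_scope.
Local Open Scope ring_scope.

(** Let T be such that every module is a direct summand of an extension E of a sum
of copies of T by a sum of copies of T, and let X be a summand of such an E, of
finite projective dimension; the complement Y of X in E may have infinite
projective dimension. The task is to bound the projective dimension of X in terms
of T alone.

E has as resolution the cone of a chain map c, from the shifted resolution of the
quotient T^l to that of the subobject T^k, and X corresponds to an endomorphism e
of this cone, idempotent up to homotopy, that vanishes in high degrees. A map of
syzygies is called null if it factors through a projective module. As Hom groups
have finite length over the artinian ground ring, the maps between n-th syzygies of
sums of copies of T which become null after passing to some further syzygies do so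
after a bounded number of steps [null_stationary]. The proof shows that e is null
from a bounded degree on [null_bound]; then the identity of the corresponding syzygy
of X is null, so this syzygy is projective [retract_bound].

The component T^k -> T^l of e factors through X, so it becomes null, hence does so in
a bounded degree. From there on e is homotopic to a triangular map [triangular], with
diagonal components al and be that commute with c up to homotopy. In high degrees e
is null, and this says that on maps modulo eventually null maps c is injective up to
elements killed by be, and that the image of al lies in the image of c. Injectivity
holds in all degrees. The central point is that the second property, in the weaker
form that every element is carried into the image of c by a power of al, holds from a
bounded degree on [surjectivity_descent]. It is equivalent to the equality of two
lengths, taken after inverting al and be. These lengths are additive, and the
composition factors of the groups of maps into all higher syzygies of T are among the
finitely many composition factors of the endomorphism rings of two of the syzygies
of T; so, as functions of the degree, the lengths are combinations, with coefficients
independent of e, of finitely many numbers [length_formula]. Equality is thus a linear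
condition in finitely many unknowns, and such conditions on the tails of a sequence
stabilise [counting_stationary]. This argument plays the part of the Igusa-Todorov function,
whose usual estimate requires all of E to have finite projective dimension.

Hence some power of al factors through c in a bounded degree, so that the same power
of e is null on T^k and, up to homotopy, factors as eps b through the projection b to
T^l. The square of b eps is b (eps b) eps, which becomes null because e does; being an
endomorphism of a sum of copies of T, it is null in a bounded degree. So the cube of
eps b is null there, and this cube is equivalent to e. *)

(** * Lengths after inverting an operator *)

Section Chains.
Variables (N : zmodType) (I : Type) (op : I -> N -> N) (th : N -> N).

Definition stable (X : set N) : Prop :=
  [/\ X 0, forall x y, X x -> X y -> X (x - y) & forall i x, X x -> X (op i x)].

Definition invariant (X : set N) : Prop := forall x, X x -> X (th x).

(** The traces on X of the submodules of the localisation of X at th. *)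
Definition saturated (X Z : set N) : Prop :=
  [/\ stable Z, invariant Z, Z `<=` X & forall x, X x -> Z (th x) -> Z x].

Inductive chain (Y X : set N) : nat -> set N -> Prop :=
| chain0 Z : saturated X Z -> Y `<=` Z -> chain Y X 0 Z
| chainS n W Z : chain Y X n W -> saturated X Z -> W `<=` Z -> ~ (Z `<=` W) ->
    chain Y X n.+1 Z.

Definition bounded (Y X : set N) (n : nat) : Prop :=
  forall m Z, chain Y X m Z -> (m <= n)%N.

(** The length of X / Y after inverting th, as a relation, so that unbounded chains
need no conventional value. *)
Definition stable_length (Y X : set N) (n : nat) : Prop :=
  (exists Z, chain Y X n Z) /\ bounded Y X n.

Lemma stableN (X : set N) x : stable X -> X x -> X (- x).
Proof. by move=> [X0 XB _] Xx; rewrite -sub0r; apply: XB. Qed.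

Lemma stableD (X : set N) x y : stable X -> X x -> X y -> X (x + y).
Proof.
move=> sX Xx Xy; rewrite -(opprK y); case: (sX) => _ XB _; apply: XB => //.
exact: stableN.
Qed.

Lemma stable_congr_r (X : set N) x y : stable X -> X (x - y) -> X y -> X x.
Proof. by move=> sX Xxy Xy; rewrite -(subrK y x); apply: stableD. Qed.

Lemma stable_congr_l (X : set N) x y : stable X -> X (x - y) -> X x -> X y.
Proof.
move=> sX Xxy Xx; rewrite -(subKr x y); case: (sX) => _ XB _; exact: XB.
Qed.

Lemma stableI (X Y : set N) : stable X -> stable Y -> stable (X `&` Y).
Proof.
move=> [X0 XB Xo] [Y0 YB Yo]; split=> //.
- by move=> x y [Xx Yx] [Xy Yy]; split; [apply: XB | apply: YB].
- by move=> i x [Xx Yx]; split; [apply: Xo | apply: Yo].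
Qed.

Lemma stable_sum (X : set N) (K : Type) (r : seq K) (P : pred K) (F : K -> N) :
  stable X -> (forall k, P k -> X (F k)) -> X (\sum_(k <- r | P k) F k).
Proof.
move=> sX XF; elim/big_ind: _ => //; first by case: sX.
by move=> x y; apply: stableD.
Qed.

Lemma chain_saturated Y X n Z : chain Y X n Z -> saturated X Z.
Proof. by case. Qed.

Lemma chain_sub Y X n Z : chain Y X n Z -> Y `<=` Z.
Proof.
by elim=> // {}n W {}Z _ YW _ WZ _; apply: subset_trans WZ.
Qed.

Lemma chain_top Y X n Z Z' : chain Y X n Z -> saturated X Z' -> Z `<=` Z' -> chain Y X n Z'.
Proof.
case=> [W gW YW|{}n V W cV gW VW nWV] gZ' WZ'.
  by apply: chain0 => //; apply: subset_trans WZ'.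
apply: chainS cV gZ' _ _; first exact: subset_trans WZ'.
by move=> Z'V; apply: nWV; apply: subset_trans Z'V.
Qed.

Lemma subrACA (x y z t : N) : (x - y) - (z - t) = (x - z) - (y - t).
Proof. by rewrite !opprD !opprK addrACA. Qed.

Lemma saturated_self X : stable X -> invariant X -> saturated X X.
Proof. by move=> sX iX; split. Qed.

Lemma stable_length_inj Y X m n : stable_length Y X m -> stable_length Y X n -> m = n.
Proof.
move=> [[Z cZ] bm] [[Z' cZ'] bn]; apply/eqP; rewrite eqn_leq.
by rewrite (bn _ _ cZ) (bm _ _ cZ').
Qed.

Lemma bounded_stable_length Y X n : stable X -> invariant X -> Y `<=` X ->
  bounded Y X n -> exists m, stable_length Y X m.
Proof.
move=> sX iX YX b.
have e0 : exists m, `[< exists Z, chain Y X m Z >].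
  by exists 0%N; apply/asboolP; exists X; exact: chain0 (saturated_self sX iX) _.
have eb m : `[< exists Z, chain Y X m Z >] -> (m <= n)%N.
  by move=> /asboolP[Z]; apply: b.
case: (ex_maxnP e0 eb) => m /asboolP mX mmax; exists m; split=> // p Z cZ.
by apply: mmax; apply/asboolP; exists Z.
Qed.

Lemma stable_length_refl X : stable X -> invariant X -> stable_length X X 0.
Proof.
move=> sX iX; split; first by exists X; exact: chain0 (saturated_self sX iX) _.
move=> m Z; case=> // n W {}Z cW gZ WZ nZW; case: nZW.
by apply: subset_trans (chain_sub cW); case: gZ.
Qed.

Hypothesis opB : forall i x y, op i (x - y) = op i x - op i y.
Hypothesis thB : forall x y, th (x - y) = th x - th y.
Hypothesis th_op : forall i x, th (op i x) = op i (th x).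

Lemma iter_thB j x y : iter j th (x - y) = iter j th x - iter j th y.
Proof. by elim: j => //= j ->. Qed.

Lemma iter_th_op j i x : iter j th (op i x) = op i (iter j th x).
Proof. by elim: j => //= j ->. Qed.

Lemma op0 i : op i 0 = 0. Proof. by rewrite -(subrr 0) opB !subrr. Qed.

Lemma iter_invariant X j x : invariant X -> X x -> X (iter j th x).
Proof. by move=> iX Xx; elim: j => //= j; apply: iX. Qed.

Definition saturation (X Z : set N) : set N :=
  [set x | X x /\ exists j, Z (iter j th x)].

Lemma saturation_saturated X Z : stable X -> invariant X -> stable Z -> invariant Z ->
  saturated X (saturation X Z).
Proof.
move=> sX iX sZ iZ; have [X0 XB Xo] := sX; have [Z0 ZB Zo] := sZ; split.
- split.
  + by split; [|exists 0%N].
  + move=> x y [Xx [j Zx]] [Xy [k Zy]]; split; first exact: XB.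
    exists (k + j)%N; rewrite iter_thB iterD addnC iterD.
    by apply: ZB; apply: iter_invariant.
  + move=> i x [Xx [j Zx]]; split; first exact: Xo.
    by exists j; rewrite iter_th_op; apply: Zo.
- move=> x [Xx [j Zx]]; split; first exact: iX.
  by exists j; rewrite -iterSr /=; apply: iZ.
- by move=> x [].
- by move=> x Xx [_ [j Zx]]; split=> //; exists j.+1; rewrite iterSr.
Qed.

Lemma saturation_le X Z W : invariant X -> saturated X W -> Z `<=` W ->
  saturation X Z `<=` W.
Proof.
move=> iX [sW iW WX satW] ZW x [Xx [j]]; elim: j x Xx => [|j IH] x Xx.
  by move=> /ZW.
by rewrite iterSr => Zx; apply: satW => //; apply: IH => //; apply: iX.
Qed.

Lemma sub_saturation X Z : Z `<=` X -> Z `<=` saturation X Z.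
Proof. by move=> ZX x Zx; split; [apply: ZX | exists 0%N]. Qed.

Lemma stable_addset (X Z : set N) : stable X -> stable Z ->
  stable [set x | exists2 y, X y & Z (x - y)].
Proof.
move=> [X0 XB Xo] [Z0 ZB Zo]; split.
- by exists 0; rewrite ?subr0.
- move=> x x' [y Xy Zy] [y' Xy' Zy']; exists (y - y'); first exact: XB.
  by rewrite subrACA; apply: ZB.
- move=> i x [y Xy Zy]; exists (op i y); first exact: Xo.
  by rewrite -opB; apply: Zo.
Qed.

Lemma invariant_addset (X Z : set N) : invariant X -> invariant Z ->
  invariant [set x | exists2 y, X y & Z (x - y)].
Proof.
by move=> iX iZ x [y Xy Zy]; exists (th y); [exact: iX | rewrite -thB; exact: iZ].
Qed.

Section Additivity.
Variables Y X Z : set N.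
Hypotheses (sX : stable X) (iX : invariant X) (sZ : stable Z) (iZ : invariant Z).
Hypotheses (XZ : X `<=` Z).

(** Saturating in Z keeps inclusions strict, because the terms are already
saturated in X. *)
Lemma chain_cat_bottom n W : chain Y X n W -> chain Y Z n (saturation Z W).
Proof.
elim=> [{}W gW YW|{}n V {}W cV IH gW VW nWV].
  have [sW iW WX _] := gW; apply: chain0; first exact: saturation_saturated.
  by apply: subset_trans YW _; apply: sub_saturation; apply: subset_trans XZ.
have [sW iW WX _] := gW; have [sV iV VX satV] := chain_saturated cV.
apply: (chainS IH); first exact: saturation_saturated.
  by move=> x [Zx [j Wx]]; split=> //; exists j; apply: VW.
move=> WV; apply: nWV => x Wx; have Zx : Z x by apply/XZ/WX.
have [|_ [j Vx]] := WV x; first exact: sub_saturation (subset_trans WX XZ) _ Wx.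
apply: (saturation_le iX (chain_saturated cV) (@subset_refl _ _)).
by split; [exact: WX | exists j].
Qed.

Lemma chain_cat n m W W' : chain Y X n W -> chain X Z m W' -> chain Y Z (n + m) W'.
Proof.
move=> cW; elim=> [{}W' gW' XW'|{}m V {}W' cV IH gW' VW' nW'V].
  rewrite addn0; apply: (chain_top (chain_cat_bottom cW) gW').
  have [_ _ WX _] := chain_saturated cW.
  by apply: (saturation_le iZ gW'); apply: subset_trans XW'.
by rewrite addnS; apply: chainS IH gW' VW' nW'V.
Qed.

Lemma saturated_trace W : saturated Z W -> saturated X (W `&` X).
Proof.
move=> [sW iW WZ satW]; split.
- exact: stableI.
- by move=> x [Wx Xx]; split; [exact: iW | exact: iX].
- by move=> x [].
- by move=> x Xx [Wx _]; split=> //; apply: satW => //; apply: XZ.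
Qed.

(** At each step of a chain in Z either the trace on X or the image modulo X grows:
otherwise a power of th carries any new element into the smaller term, which is
saturated. *)
Lemma chain_split p W : Y `<=` X -> chain Y Z p W ->
  exists n m, [/\ (p <= n + m)%N, chain Y X n (W `&` X) &
    chain X Z m (saturation Z [set x | exists2 y, W y & X (x - y)])].
Proof.
move=> YX; elim=> [{}W gW YW|{}p V {}W cV [n [m [pnm cn cm]]] gW VW nWV].
  have [sW iW WZ satW] := gW.
  exists 0%N, 0%N; split=> //.
    by apply: chain0; [exact: saturated_trace | move=> x Yx; split; [exact: YW | exact: YX]].
  apply: chain0; first apply: saturation_saturated => //.
  - exact: stable_addset.
  - exact: invariant_addset.
  - move=> x Xx; split; first exact: XZ.
    by exists 0%N, 0; [case: sW | rewrite subr0].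
have [sW iW WZ satW] := gW; have gV := chain_saturated cV; have [sV iV VZ satV] := gV.
have g1 := saturated_trace gW.
have g2 : saturated Z (saturation Z [set x | exists2 y, W y & X (x - y)]).
  by apply: saturation_saturated => //; [exact: stable_addset | exact: invariant_addset].
have s1 : V `&` X `<=` W `&` X by move=> x [/VW].
have s2 : saturation Z [set x | exists2 y, V y & X (x - y)] `<=`
          saturation Z [set x | exists2 y, W y & X (x - y)].
  by move=> x [Zx [j [y Vy Xy]]]; split=> //; exists j, y => //; apply: VW.
have [WXV|nWXV] := pselect (W `&` X `<=` V `&` X); last first.
  exists n.+1, m; split; first by rewrite addSn ltnS.
    exact: chainS cn g1 s1 nWXV.
  exact: chain_top cm g2 s2.
exists n, m.+1; split; first by rewrite addnS ltnS.
  exact: chain_top cn g1 s1.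
apply: chainS cm g2 s2 _ => WV; apply: nWV => x Wx.
have [|_ [j [y Vy Xy]]] := WV x.
  split; first exact: WZ.
  by exists 0%N, x => //; rewrite subrr; case: sX.
have [X0 _ _] := sX.
have Vx : V (iter j th x).
  apply: (stable_congr_r sV _ Vy).
  suff [] : (V `&` X) (iter j th x - y) by [].
  apply: WXV; split=> //; case: (sW) => _ WB _; apply: WB; [exact: iter_invariant | exact: VW].
apply: (saturation_le iZ gV (@subset_refl _ _)).
by split; [exact: WZ | exists j].
Qed.

Lemma bounded_add n m : Y `<=` X -> bounded Y X n -> bounded X Z m ->
  bounded Y Z (n + m).
Proof.
move=> YX bn bm p W /(chain_split YX)[n' [m' [pnm cn cm]]].
by apply: leq_trans pnm _; apply: leq_add; [exact: bn cn | exact: bm cm].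
Qed.

Lemma stable_length_add n m : Y `<=` X -> stable_length Y X n -> stable_length X Z m ->
  stable_length Y Z (n + m).
Proof.
move=> YX [[W cW] bn] [[W' cW'] bm]; split; last exact: bounded_add.
by exists W'; apply: chain_cat cW cW'.
Qed.

End Additivity.

(** Localisation kills X / Y exactly when th is locally nilpotent on it. *)
Lemma stable_length0P Y X : stable X -> invariant X -> stable Y -> invariant Y -> Y `<=` X ->
  stable_length Y X 0 <-> forall x, X x -> exists j, Y (iter j th x).
Proof.
move=> sX iX sY iY YX; split=> [[_ b] x Xx|satY].
  apply: contrapT => nY.
  have gX := saturated_self sX iX.
  have gY := saturation_saturated sX iX sY iY.
  have c0 : chain Y X 0 (saturation X Y) by apply: chain0 => //; exact: sub_saturation.
  have nXY : ~ X `<=` saturation X Y by move=> /(_ x Xx)[].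
  have /b : chain Y X 1 X by apply: chainS c0 gX _ nXY => y [].
  by [].
split; first by exists X; exact: chain0 (saturated_self sX iX) _.
move=> m Z; case=> // n W {}Z cW gZ WZ nZW; case: nZW => x Zx.
have [_ _ ZX _] := gZ; have Xx := ZX x Zx.
apply: (saturation_le iX (chain_saturated cW) (chain_sub cW)).
by split=> //; apply: satY.
Qed.

End Chains.

Section Transfer.
Variables (N' N : zmodType) (I : Type).
Variables (op' : I -> N' -> N') (th' : N' -> N') (op : I -> N -> N) (th : N -> N).
Hypothesis opB : forall i x y, op i (x - y) = op i x - op i y.
Hypothesis thB : forall x y, th (x - y) = th x - th y.
Variables (f : N' -> N) (X' : set N') (Y X : set N).
Hypotheses (sX' : stable op' X') (iX' : invariant th' X').
Hypotheses (sY : stable op Y) (iY : invariant th Y).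
Hypotheses (sX : stable op X) (iX : invariant th X) (YX : Y `<=` X).
Hypothesis fB : forall x y, X' x -> X' y -> f (x - y) = f x - f y.
Hypothesis f_op : forall i x, X' x -> Y (op i (f x) - f (op' i x)).
Hypothesis f_th : forall x, X' x -> Y (th (f x) - f (th' x)).
Hypothesis fX : forall x, X' x -> X (f x).
Hypothesis f_surj : forall x, X x -> exists2 x', X' x' & Y (x - f x').

Let Y' : set N' := [set x | X' x /\ Y (f x)].
Let im (W : set N') : set N := [set x | exists2 w, W w & Y (x - f w)].
Let pre (W : set N) : set N' := [set x | X' x /\ W (f x)].

Lemma transfer_f0 : f 0 = 0.
Proof. by have [X0 _ _] := sX'; rewrite -(subrr 0) fB // subrr. Qed.

Lemma transfer_im_saturated W : saturated op' th' X' W -> Y' `<=` W -> saturated op th X (im W).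
Proof.
move=> [[W0 WB Wo] iW WX' satW] YW; have [Y0 YB Yo] := sY; split.
- split.
  + by exists 0 => //; rewrite transfer_f0 subr0.
  + move=> x y [w Ww Yw] [v Wv Yv]; exists (w - v); first exact: WB.
    rewrite fB; [|exact: WX'|exact: WX'].
    by rewrite subrACA; exact: YB.
  + move=> i x [w Ww Yw]; exists (op' i w); first exact: Wo.
    rewrite -(subrKA (op i (f w))); apply: (stableD sY); last exact: f_op (WX' _ Ww).
    by rewrite -opB; apply: Yo.
- move=> x [w Ww Yw]; exists (th' w); first exact: iW.
  rewrite -(subrKA (th (f w))); apply: (stableD sY); last exact: f_th (WX' _ Ww).
  by rewrite -thB; apply: iY.
- by move=> x [w Ww Yw]; apply: (stable_congr_r sX (YX Yw)); apply/fX/WX'.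
- move=> x Xx [w Ww Yw]; have [x' X'x' Yx'] := f_surj Xx; exists x' => //.
  apply: satW => //.
  suff Y'w : Y' (w - th' x').
    by rewrite -(subKr w (th' x')); apply: WB => //; apply: YW.
  split; first by case: sX' => _ XB' _; apply: XB'; [exact: WX' | exact: iX'].
  rewrite fB; [|exact: WX'|exact: iX'].
  have -> : f w - f (th' x') = (th x - f (th' x')) - (th x - f w).
    by rewrite opprB [RHS]addrC subrKA.
  apply: YB => //; rewrite -(subrKA (th (f x'))); apply: (stableD sY).
    by rewrite -thB; apply: iY.
  exact: f_th.
Qed.

Lemma transfer_pre_saturated W : saturated op th X W -> Y `<=` W -> saturated op' th' X' (pre W).
Proof.
move=> [sW iW WX satW] YW; have [W0 WB Wo] := sW; have [X0' XB' Xo'] := sX'; split.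
- split.
  + by split=> //; rewrite transfer_f0.
  + move=> x y [Xx Wx] [Xy Wy]; split; first exact: XB'.
    by rewrite fB //; apply: WB.
  + move=> i x [Xx Wx]; split; first exact: Xo'.
    by apply: (stable_congr_l sW (YW _ (f_op i Xx))); apply: Wo.
- move=> x [Xx Wx]; split; first exact: iX'.
  by apply: (stable_congr_l sW (YW _ (f_th Xx))); apply: iW.
- by move=> x [].
- move=> x Xx [_ Wx]; split=> //; apply: satW; first exact: fX.
  exact: (stable_congr_r sW (YW _ (f_th Xx))).
Qed.

Lemma transfer_im n W : chain op' th' Y' X' n W -> chain op th Y X n (im W).
Proof.
elim=> [{}W gW YW|{}n V {}W cV IH gW VW nWV].
  apply: chain0; first exact: transfer_im_saturated.
  by move=> x Yx; have [[W0 _ _] _ _ _] := gW; exists 0; rewrite ?transfer_f0 ?subr0.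
have YV := chain_sub cV; have YW := subset_trans YV VW.
apply: chainS IH _ _ _; first exact: transfer_im_saturated.
  by move=> x [w Vw Yw]; exists w => //; apply: VW.
move=> WV; apply: nWV => x Wx; have [Y0 _ _] := sY.
have [|v Vv Yv] := WV (f x); first by exists x => //; rewrite subrr.
have [sV _ VX' _] := chain_saturated cV; have [_ _ WX' _] := gW.
apply: (stable_congr_r sV _ Vv); apply: YV; split.
  by case: sX' => _ XB' _; apply: XB'; [exact: WX' | exact/WX'/VW].
by rewrite fB //; [exact: WX' | exact/WX'/VW].
Qed.

Lemma transfer_pre n W : chain op th Y X n W -> chain op' th' Y' X' n (pre W).
Proof.
elim=> [{}W gW YW|{}n V {}W cV IH gW VW nWV].
  apply: chain0; first exact: transfer_pre_saturated.
  by move=> x [Xx Yx]; split=> //; apply: YW.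
have YV := chain_sub cV; have YW := subset_trans YV VW.
apply: chainS IH _ _ _; first exact: transfer_pre_saturated.
  by move=> x [Xx Wx]; split=> //; apply: VW.
move=> WV; apply: nWV => x Wx.
have [sV _ VX _] := chain_saturated cV; have [sW _ WX _] := gW.
have [x' Xx' Yx] := f_surj (WX _ Wx).
apply: (stable_congr_r sV (YV _ Yx)).
suff [] : pre V x' by [].
by apply: WV; split=> //; apply: (stable_congr_l sW (YW _ Yx)).
Qed.

Lemma transfer_bounded n : bounded op' th' Y' X' n <-> bounded op th Y X n.
Proof.
by split=> b m W; [move=> /transfer_pre/b | move=> /transfer_im/b].
Qed.

(** f induces an isomorphism from X' / Y' to X / Y. It commutes with the operators
only modulo Y, because later the operators will commute with f only up to null maps. *)
Lemma transfer_stable_length n : stable_length op' th' Y' X' n <-> stable_length op th Y X n.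
Proof.
split=> [[[W cW] b]|[[W cW] b]]; split; try exact/transfer_bounded.
  by exists (im W); apply: transfer_im.
by exists (pre W); apply: transfer_pre.
Qed.

End Transfer.

(** * Modules of finite length *)

Definition finite_length (N : zmodType) (I : Type) (op : I -> N -> N) (X : set N) :=
  exists n, bounded op id [set 0] X n.

Lemma invariant_id (N : zmodType) (X : set N) : invariant id X.
Proof. by []. Qed.
#[local] Hint Resolve invariant_id : core.

Lemma saturated_id (N : zmodType) (I : Type) (op : I -> N -> N) (X Z : set N) :
  stable op Z -> Z `<=` X -> saturated op id X Z.
Proof. by move=> sZ ZX; split. Qed.

(** More operators and the inversion of th only shorten chains; all finiteness
questions thus reduce to lengths over the ground ring. *)
Lemma chain_forget (N : zmodType) (I I' : Type) (op' : I' -> N -> N) (th : N -> N)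
    (op : I -> N -> N) (Y X Y' X' W : set N) n :
  (forall Z, stable op' Z -> stable op Z) -> Y' `<=` Y -> X `<=` X' ->
  chain op' th Y X n W -> chain op id Y' X' n W.
Proof.
move=> op_op' YY' XX'; elim=> [{}W [sW iW WX _] YW|{}n V {}W _ IH [sW iW WX _] VW nWV].
  apply: chain0; last exact: subset_trans YW.
  by apply: saturated_id; [exact: op_op' | exact: subset_trans XX'].
apply: (chainS IH) => //.
by apply: saturated_id; [exact: op_op' | exact: subset_trans XX'].
Qed.

Section FiniteLength.
Variables (N : zmodType) (I : Type) (op : I -> N -> N).
Hypothesis opB : forall i x y, op i (x - y) = op i x - op i y.

Lemma stable0 : stable op [set 0].
Proof.
split=> //; first by move=> x y /= -> ->; rewrite subrr.
by move=> i x /= ->; rewrite op0.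
Qed.

Lemma finite_length_sub (X X' : set N) : X `<=` X' ->
  finite_length op X' -> finite_length op X.
Proof.
move=> XX' [n b]; exists n => m W cW; apply: (b m W).
by apply: chain_forget cW.
Qed.

Lemma finite_length_bounded (I' : Type) (op' : I' -> N -> N) (th : N -> N) Y X :
  (forall Z, stable op' Z -> stable op Z) -> Y 0 -> finite_length op X ->
  exists n, bounded op' th Y X n.
Proof.
move=> h Y0 [n b]; exists n => m W cW; apply: (b m W).
by apply: chain_forget cW => // x ->.
Qed.

Lemma finite_length_stationary (X : set N) (J : nat -> set N) :
  finite_length op X -> (forall m, stable op (J m)) -> (forall m, J m `<=` X) ->
  (forall m, J m `<=` J m.+1) -> exists m, forall m', J m' `<=` J m.
Proof.
move=> [b bX] sJ JX Jm; apply: contrapT => nJ.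
have Jle m m' : (m <= m')%N -> J m `<=` J m'.
  move=> /subnK <-; elim: (m' - m)%N => [|k IH] //.
  by apply: subset_trans IH _; rewrite addSn.
suff /(_ b.+1)[m /bX]: forall n, exists m, chain op id [set 0] X n (J m).
  by rewrite ltnn.
elim=> [|n [m cm]].
  exists 0%N; apply: chain0; first by apply: saturated_id.
  by move=> x ->; case: (sJ 0%N).
have [m' nm'] : exists m', ~ J m' `<=` J m.
  by apply: contrapT => h; apply: nJ; exists m => m'; apply: contrapT => h'; apply: h; exists m'.
exists (maxn m m'); apply: (chainS cm); first exact: saturated_id.
  exact/Jle/leq_maxl.
by move=> h; apply: nm' => x Jx; apply: h; apply: Jle Jx; apply: leq_maxr.
Qed.

(** Impredicative, so that stability and minimality are immediate. *)
Definition span (s : seq N) : set N :=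
  [set x | forall Z, stable op Z -> (forall y, y \in s -> Z y) -> Z x].

Lemma span_stable s : stable op (span s).
Proof.
split.
- by move=> Z [].
- by move=> x y sx sy Z sZ hZ; case: (sZ) => _ ZB _; apply: ZB; [exact: sx | exact: sy].
- by move=> i x sx Z sZ hZ; case: (sZ) => _ _; apply; apply: sx.
Qed.

Lemma finite_length_span (X : set N) : stable op X -> finite_length op X ->
  exists2 s, (forall y, y \in s -> X y) & X `<=` span s.
Proof.
move=> sX [b bX]; apply: contrapT => nX.
suff /(_ b.+1)[s sX' /bX]: forall n, exists2 s, (forall y, y \in s -> X y) &
    chain op id [set 0] X n (span s) by rewrite ltnn.
have spanX s : (forall y, y \in s -> X y) -> span s `<=` X by move=> h x; apply.
elim=> [|n [s sX' cs]].
  exists [::] => //; apply: chain0; last by move=> x ->; case: (span_stable [::]).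
  by apply: saturated_id; [exact: span_stable | exact: spanX].
have [x [Xx nx]] : exists x, X x /\ ~ span s x.
  apply: contrapT => h; apply: nX; exists s => // x Xx.
  by apply: contrapT => h'; apply: h; exists x.
have xX y : y \in x :: s -> X y by rewrite inE => /predU1P[->|/sX'].
exists (x :: s) => //; apply: (chainS cs).
- by apply: saturated_id; [exact: span_stable | exact: spanX].
- by move=> y sy Z sZ hZ; apply: sy => // w ws; apply: hZ; rewrite inE ws orbT.
- by move=> h; apply: nx; apply: h => Z _; apply; rewrite inE eqxx.
Qed.

End FiniteLength.

Section Family.
Variables (N' N : zmodType) (I : Type) (op' : I -> N' -> N') (op : I -> N -> N).
Hypothesis op'B : forall i x y, op' i (x - y) = op' i x - op' i y.
Hypothesis opB : forall i x y, op i (x - y) = op i x - op i y.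

(** The common kernels of initial parts of the family filter X', and each successive
quotient embeds into X. *)
Lemma finite_length_family (K : finType) (p : K -> N' -> N) (X' : set N') (X : set N) :
  stable op' X' -> finite_length op X ->
  (forall k x y, X' x -> X' y -> p k (x - y) = p k x - p k y) ->
  (forall k i x, X' x -> p k (op' i x) = op i (p k x)) ->
  (forall k x, X' x -> X (p k x)) ->
  (forall x, X' x -> (forall k, p k x = 0) -> x = 0) ->
  finite_length op' X'.
Proof.
move=> sX' [b bX] pB p_op pX p_inj.
pose Z (l : seq K) := [set x | X' x /\ forall k, k \in l -> p k x = 0].
have p0 k : p k 0 = 0.
  by have [X0 _ _] := sX'; rewrite -(subrr 0) pB // subrr.
have sZ l : stable op' (Z l).
  have [X0 XB Xo] := sX'; split.
  - by split.
  - move=> x y [Xx px] [Xy py]; split; first exact: XB.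
    by move=> k kl; rewrite pB // px // py // subrr.
  - move=> i x [Xx px]; split; first exact: Xo.
    by move=> k kl; rewrite p_op // px // op0.
suff /(_ (enum K))[n bn] : forall l, exists n, bounded op' id (Z l) X' n.
  exists n => m W cW; apply: (bn m W); apply: chain_forget cW => // x [Xx px] /=.
  by apply: p_inj => // k; apply: px; rewrite mem_enum.
elim=> [|k l [n bn]].
  have -> : Z [::] = X' by apply/seteqP; split=> [x []//|x Xx]; split.
  by exists 0%N; have [] := stable_length_refl sX' (@invariant_id _ X').
exists (b + n)%N.
have ZZ : Z (k :: l) `<=` Z l.
  by move=> x [Xx px]; split=> // j jl; apply: px; rewrite inE jl orbT.
apply: (bounded_add op'B _ _ (sZ l) _ sX' _ _ ZZ _ bn) => //; first by move=> x [].
pose im := [set y | exists2 x, Z l x & y = p k x].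
have sim : stable op im.
  have [Z0 ZB Zo] := sZ l; split.
  - by exists 0; rewrite ?p0.
  - move=> _ _ [x Zx ->] [y Zy ->]; exists (x - y); first exact: ZB.
    by rewrite pB //; [case: Zx | case: Zy].
  - move=> i _ [x Zx ->]; exists (op' i x); first exact: Zo.
    by rewrite p_op //; case: Zx.
have -> : Z (k :: l) = [set x | Z l x /\ [set 0] (p k x)].
  apply/seteqP; split=> x.
    by move=> Zx; split; [exact: ZZ | case: Zx => _; apply; rewrite inE eqxx].
  move=> [[Xx px] pkx]; split=> // j; rewrite inE => /predU1P[->//|]; exact: px.
apply/(@transfer_bounded _ _ _ op' id op id opB _ (p k) (Z l) [set 0] im) => //.
- exact: stable0.
- by move=> x ->; case: sim.
- by move=> x y [Xx _] [Xy _]; apply: pB.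
- by move=> i x [Xx _]; rewrite p_op //= subrr.
- by move=> x _ /=; rewrite subrr.
- by move=> x Zx; exists x.
- by move=> x [y Zy ->]; exists y => //=; rewrite subrr.
move=> m W cW; apply: (bX m W); apply: chain_forget cW => // x [y [Xy _] ->].
exact: pX.
Qed.

End Family.

Section Artinian.
Variable R : comNzRingType.

Definition ideal_op (r x : R^o) : R^o := r * x.

Lemma ideal_opB r x y : ideal_op r (x - y) = ideal_op r x - ideal_op r y.
Proof. exact: mulrBr. Qed.

(** Dependent choice turns the descending chain condition into minimal elements. *)
Lemma artinian_min (Q : set R^o -> Prop) (X : set R^o) : artinian R ->
  stable ideal_op X -> Q X -> exists M, [/\ stable ideal_op M, Q M &
    forall M', stable ideal_op M' -> Q M' -> M' `<=` M -> M `<=` M'].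
Proof.
move=> artR sX QX; apply: contrapT => nM.
pose T := {M : set R^o | stable ideal_op M /\ Q M}.
have next (M : T) : {M' : T | projT1 M' `<=` projT1 M /\ ~ projT1 M `<=` projT1 M'}.
  apply: cid; apply: contrapT => h; apply: nM; exists (projT1 M).
  have [sM QM] := projT2 M; split=> // M' sM' QM' M'M; apply: contrapT => h'.
  by apply: h; exists (exist _ M' (conj sM' QM')).
pose seqM n := iter n (fun M => projT1 (next M)) (exist _ X (conj sX QX) : T).
have [n hn] : exists n, forall m, (n <= m)%N ->
    [pred x : R^o | `[< projT1 (seqM m) x >]] =i [pred x : R^o | `[< projT1 (seqM n) x >]].
  apply: (artR (fun n => [pred x : R^o | `[< projT1 (seqM n) x >]])).
    move=> n; have [sM _] := projT2 (seqM n); have [M0 _ Mo] := sM; split.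
      by rewrite inE.
    move=> a u v; rewrite !inE => Mu Mv.
    by apply: (stableD sM) => //; apply: Mo.
  move=> n x; rewrite !inE => h.
  by have [+ _] := projT2 (next (seqM n)); apply.
have [_] := projT2 (next (seqM n)); apply => x Mx.
have := hn n.+1 (leqnSn n) x; rewrite !inE => e.
by apply/asboolP; rewrite -/(seqM n.+1) e; apply/asboolP.
Qed.

(** Let M be minimal among the ideals of infinite length. For each r, either rM = M or
rM = 0: if rM is a proper submodule of M then it has finite length, so the kernel of r
on M has infinite length and equals M. If rM = M then r is invertible on M, because the
powers of r generate a stationary chain of ideals. So M is a vector space whose proper
subspaces have finite length, and it contains a hyperplane: it has finite length. *)
Lemma artinian_finite_length : artinian R -> finite_length ideal_op [set: R^o].
Proof.
move=> artR; apply: contrapT => nfl.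
have sT : stable ideal_op [set: R^o] by split.
have [M [sM nM minM]] :=
  @artinian_min (fun X => ~ finite_length ideal_op X) _ artR sT nfl.
have [M0 MB Mo] := sM.
have properM (X : set R^o) : stable ideal_op X -> X `<=` M -> ~ M `<=` X ->
    finite_length ideal_op X.
  by move=> sX XM nMX; apply: contrapT => h; apply: nMX; apply: minM.
have dicho r : (forall x, M x -> exists2 y, M y & x = r * y) \/ (forall x, M x -> r * x = 0).
  pose rM := [set x : R^o | exists2 y, M y & x = r * y].
  pose K := [set x : R^o | M x /\ [set 0] (r * x : R^o)].
  have srM : stable ideal_op rM.
    split; first by exists 0; rewrite ?mulr0.
      by move=> _ _ [x Mx ->] [y My ->]; exists (x - y); [exact: MB | rewrite mulrBr].
    by move=> s _ [x Mx ->]; exists (s * x); [exact: Mo | rewrite /ideal_op mulrCA].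
  have rMM : rM `<=` M by move=> _ [x Mx ->]; apply: Mo.
  have sK : stable ideal_op K.
    split; first by split=> //=; rewrite mulr0.
      by move=> x y [Mx /= x0] [My /= y0]; split; [exact: MB | rewrite /= mulrBr x0 y0 subrr].
    move=> s x [Mx /= x0]; split; first exact: Mo.
    by rewrite /= /ideal_op mulrCA x0 mulr0.
  have KM : K `<=` M by move=> x [].
  have [h|h] := pselect (M `<=` rM); [by left|right].
  have [k bk] := properM _ srM rMM h.
  apply: contrapT => h'.
  have /(properM _ sK KM)[k' bk'] : ~ M `<=` K.
    by move=> MK; apply: h' => x Mx; have [] := MK x Mx.
  apply: nM; exists (k' + k)%N.
  apply: (bounded_add ideal_opB _ _ sK _ sM) => //.
    by move=> x ->; case: sK.
  apply/(@transfer_bounded _ _ _ ideal_op id ideal_op id ideal_opB _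
     (fun x => r * x) M [set 0] rM) => //.
  - exact/stable0/ideal_opB.
  - by move=> x ->; case: srM.
  - by move=> x y _ _; rewrite mulrBr.
  - by move=> s x _; rewrite /= /ideal_op mulrCA subrr.
  - by move=> x _ /=; rewrite subrr.
  - by move=> x Mx; exists x.
  - by move=> _ [x Mx ->]; exists x => //=; rewrite subrr.
have inv r : (exists2 x, M x & r * x != 0) -> exists s, forall x, M x -> (1 - s * r) * x = 0.
  move=> [x0 Mx0 rx0].
  have rM : forall x, M x -> exists2 y, M y & x = r * y.
    by case: (dicho r) => // h; rewrite h // eqxx in rx0.
  have rnM n x : M x -> exists2 y, M y & x = r ^+ n * y.
    elim: n x => [|n IH] x Mx; first by exists x => //; rewrite expr0 mul1r.
    have [y My ->] := IH x Mx; have [w Mw ->] := rM y My.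
    by exists w => //; rewrite mulrA -exprSr.
  pose P (X : set R^o) := exists n, X = [set x : R^o | exists y, x = r ^+ n * y].
  have [|_ [_ [n ->] minX]] := @artinian_min P [set: R^o] artR sT.
    exists 0%N; apply/seteqP; split=> // x _ /=.
    by exists x; rewrite expr0 mul1r.
  have sX : stable ideal_op [set x : R^o | exists y, x = r ^+ n.+1 * y].
    split; first by exists 0; rewrite mulr0.
      by move=> _ _ [x ->] [y ->]; exists (x - y); rewrite mulrBr.
    by move=> s _ [x ->]; exists (s * x); rewrite /ideal_op mulrCA.
  have sub : [set x : R^o | exists y, x = r ^+ n.+1 * y] `<=` [set x | exists y, x = r ^+ n * y].
    by move=> _ [y ->]; exists (r * y); rewrite mulrA -exprSr.
  have [||s es] := minX _ sX _ sub (r ^+ n); [by exists n.+1 | by exists 1; rewrite mulr1 |].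
  exists s => x /(rnM n)[y My ->]; rewrite mulrA mulrBl mul1r.
  by rewrite -[s * r * _]mulrA -exprS [s * _]mulrC -es subrr mul0r.
have [x Mx x0] : exists2 x, M x & x != 0.
  apply: contrapT => h; apply: nM; exists 0%N.
  have -> : M = [set 0].
    apply/seteqP; split=> [x Mx|x ->//] /=; have [//|xn0] := eqVneq x 0.
    by case: h; exists x.
  by have [] := stable_length_refl (stable0 ideal_opB) (@invariant_id _ [set (0 : R^o)]).
pose P (X : set R^o) := [/\ X `<=` M, ~ X x,
  forall u v, X u -> X v -> X (u - v) & forall r u, X u -> X (ideal_op r u)].
(* X is the hyperplane: maximal among the submodules of M avoiding x. Membership of 0
is left out of P, so that P contains the union of the empty chain. *)
have [X [[XM nXx XB Xo] maxX]] : exists X, P X /\ forall Z, X `<` Z -> ~ P Z.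
  apply: Zorn_bigcup => F FP totF; split.
  - by move=> u [X FX Xu]; have [XM _ _ _] := FP X FX; apply: XM.
  - by move=> [X FX Xu]; have [_ + _ _] := FP X FX; apply.
  - move=> u v [X FX Xu] [Z FZ Zv].
    by case: (totF _ _ FX FZ) => h; [exists Z => //; have [_ _ + _] := FP Z FZ |
      exists X => //; have [_ _ + _] := FP X FX]; apply => //; apply: h.
  - by move=> r u [X FX Xu]; exists X => //; have [_ _ _] := FP X FX; apply.
have X0 : X 0.
  apply: contrapT => nX0; apply: (maxX (X `|` [set 0])).
    by split; [move=> u; left | move=> h; apply: nX0; apply: h; right].
  split.
  - by move=> u [/XM//|->].
  - by move=> [//|/eqP]; rewrite (negPf x0).
  - move=> u v [Xu|->] [Xv|->]; rewrite ?subr0 ?sub0r; [left|left|left|right] => //.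
      exact: XB.
    by case: nX0; rewrite -(subrr v); apply: XB.
  - by move=> r u [/(Xo r)|->]; [left | right; rewrite /= /ideal_op mulr0].
have sX : stable ideal_op X by split.
have above Z : stable ideal_op Z -> X `<=` Z -> Z `<=` M -> ~ Z `<=` X -> Z x.
  move=> sZ XZ ZM nZX; apply: contrapT => nZx; apply: (maxX Z); first by split.
  by have [_ ? ?] := sZ; split.
have XMx Z : stable ideal_op Z -> X `<=` Z -> Z x -> M `<=` Z.
  move=> sZ XZ Zx y My; have [/XZ//|nXy] := pselect (X y).
  pose Xy := [set w : R^o | exists r, X (w - r * y)].
  have [||||r Xr] := above Xy; rewrite /Xy.
  - split; first by exists 0; rewrite mul0r subr0.
      move=> u v [r Xu] [s Xv]; exists (r - s); rewrite mulrBl subrACA; exact: XB.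
    by move=> s u [r Xu]; exists (s * r); rewrite -mulrA -mulrBr; apply: Xo.
  - by move=> u Xu; exists 0; rewrite mul0r subr0.
  - by move=> u [r Xu]; apply: (stable_congr_r sM (XM _ Xu)); apply: Mo.
  - by move=> h; apply: nXy; apply: h; exists 1; rewrite mul1r subrr.
  have [s es] : exists s, forall u, M u -> (1 - s * r) * u = 0.
    apply: inv; exists y => //; apply/eqP => ry0; apply: nXx.
    by rewrite -(subr0 x) -ry0.
  have -> : y = s * (x - (x - r * y)).
    by rewrite opprB addrC subrK mulrA; apply/eqP; rewrite -subr_eq0 -{1}(mul1r y) -mulrBl es.
  by have [_ ZB Zo] := sZ; apply: Zo; apply: ZB => //; apply: XZ.
have [k bk] : finite_length ideal_op X by apply: properM => // h; apply/nXx/h.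
apply: nM; exists (k + 1)%N.
apply: (bounded_add ideal_opB _ _ sX _ sM) => //; first by move=> u ->.
move=> m W cW; rewrite leqNgt; apply/negP => m1.
case: m W / cW m1 => // n V W; case=> // n' V' {}V cV' gV V'V nV'V gW VW nWV _.
apply: nWV => w Ww; have [sV _ VM _] := gV; have XV' := chain_sub cV'.
apply: (XMx V) => //; first exact: subset_trans V'V.
  apply: above => //; first exact: subset_trans V'V.
  by move=> h; apply: nV'V; apply: subset_trans XV'.
by have [_ _ WM _] := gW; apply: WM.
Qed.

Variables (N : zmodType) (op : R -> N -> N).
Hypothesis opB : forall r x y, op r (x - y) = op r x - op r y.
Hypothesis opBl : forall r s x, op (r - s) x = op r x - op s x.
Hypothesis opM : forall r s x, op (r * s) x = op r (op s x).

Fixpoint combinations (s : seq N) : set N :=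
  if s is a :: s' then [set x | exists r, combinations s' (x - op r a)] else [set 0].

Lemma op_0l x : op 0 x = 0.
Proof. by rewrite -(subrr (0 : R)) opBl subrr. Qed.

Lemma combinations_stable s : stable op (combinations s).
Proof.
elim: s => [|a s IH]; first exact: stable0.
have [C0 CB Co] := IH; split.
- by exists 0; rewrite op_0l subrr.
- by move=> x y [r Cx] [t Cy]; exists (r - t); rewrite opBl subrACA; apply: CB.
- by move=> t x [r Cx]; exists (t * r); rewrite opM -opB; apply: Co.
Qed.

Lemma combinations_sum (K : eqType) (l : seq K) (c : K -> R) (g : K -> N) :
  combinations (map g l) (\sum_(k <- l) op (c k) (g k)).
Proof.
elim: l => [|k l IH] /=; first by rewrite big_nil.
by exists (c k); rewrite big_cons addrC addKr.
Qed.

(** Adjoining a generator a adds a quotient of R, through the map r |-> r a. *)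
Lemma finite_length_combinations s :
  finite_length ideal_op [set: R^o] -> finite_length op (combinations s).
Proof.
move=> flR; elim: s => [|a s [n bn]].
  by exists 0%N; have [] := stable_length_refl (stable0 opB) (@invariant_id _ [set (0 : N)]).
have sC := combinations_stable s; have [C0 CB Co] := sC.
have sCa := combinations_stable (a :: s).
have le : combinations s `<=` combinations (a :: s).
  by move=> x Cx; exists 0; rewrite op_0l subr0.
have [m bm] : exists m, bounded ideal_op id
    [set r : R^o | [set: R^o] r /\ combinations s (op r a)] [set: R^o] m.
  by apply: finite_length_bounded flR => //=; split=> //; rewrite op_0l.
exists (n + m)%N; apply: (bounded_add opB _ _ sC _ sCa) => //.
  by move=> x ->.
apply/(@transfer_bounded _ _ _ ideal_op id op id opB _ (fun r : R^o => op r a) [set: R^o]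
  (combinations s) (combinations (a :: s))) => //.
- by move=> r t _; rewrite /ideal_op opM subrr; exact: C0.
- by move=> r _; rewrite /= subrr; exact: C0.
- by move=> r _; exists r; rewrite subrr; exact: C0.
- by move=> x [r Cx]; exists r.
Qed.

End Artinian.

(** * Complexes of projectives and projectively trivial maps *)

Definition mklinear (A : pzRingType) (U V : lmodType A) (f : U -> V)
  (f_lin : linear f) : {linear U -> V} :=
  HB.pack f (GRing.isLinear.Build A U V *:%R f f_lin).

Section Submodule.
Variables (A : pzRingType) (V : lmodType A).
(** Bundled, so that the subtype below determines the closure proof. *)
Record submodule := Submodule
  { submodule_mem : {pred V}; submodule_closed : submod_closed submodule_mem }.
HB.instance Definition _ (S : submodule) :=
  GRing.isSubmodClosed.Build A V (submodule_mem S) (submodule_closed S).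
Variable S : submodule.
Definition submodule_type := {x : V | x \in submodule_mem S}.
HB.instance Definition _ := SubChoice.on submodule_type.
HB.instance Definition _ := [SubChoice_isSubLmodule of submodule_type by <:].
End Submodule.

Section Lifting.
Variable A : pzRingType.

Lemma image_closed (W V : lmodType A) (g : {linear W -> V}) :
  submod_closed [pred v | `[< exists w, g w = v >]].
Proof.
split; first by rewrite inE; exists 0; rewrite linear0.
move=> a u v; rewrite !inE => -[w <-] [w' <-]; exists (a *: w + w').
by rewrite linearP.
Qed.

(** Projectivity provides lifts along surjections only: corestrict g to its image. *)
Lemma projective_lift (P V W : lmodType A) (f : {linear P -> V}) (g : {linear W -> V}) :
  projective P -> (forall x, exists y, g y = f x) ->
  exists h : {linear P -> W}, forall x, g (h x) = f x.
Proof.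
move=> projP fg; pose S := Submodule (image_closed g).
have Sg w : g w \in submodule_mem S by rewrite inE; exists w.
have Sf x : f x \in submodule_mem S by rewrite inE; apply: fg.
pose g' w : submodule_type S := exist _ (g w) (Sg w).
pose f' x : submodule_type S := exist _ (f x) (Sf x).
have g'lin : linear g' by move=> a u v; apply: val_inj; rewrite /= linearP.
have f'lin : linear f' by move=> a u v; apply: val_inj; rewrite /= linearP.
have [|h hP] := projP _ _ (mklinear g'lin) (mklinear f'lin).
  move=> [v Sv]; have := Sv; rewrite inE => -[w gw]; exists w.
  exact: val_inj.
by exists h => x; have /(congr1 val) := hP x.
Qed.

End Lifting.

(** The sequence starts at an arbitrary index n and takes default values before it.
Recursion on n, with a shift of the family X, avoids transport along equalities of
indices. *)
Lemma dependent_choice_nat (X : nat -> Type) (d : forall m, X m) n (x0 : X n)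
    (Q : forall m, X m -> Prop) (E : forall m, X m -> X m.+1 -> Prop) :
  Q n x0 ->
  (forall m, (n <= m)%N -> forall x, Q m x -> exists y, Q m.+1 y /\ E m x y) ->
  exists s : forall m, X m, s n = x0 /\
    forall m, (n <= m)%N -> Q m (s m) /\ E m (s m) (s m.+1).
Proof.
elim: n X d x0 Q E => [|n IH] X d x0 Q E Q0 step.
  have next m (x : {x | Q m x}) : {y : {y | Q m.+1 y} | E m (projT1 x) (projT1 y)}.
    apply: cid; have [y [Qy Ey]] := step m isT _ (projT2 x).
    by exists (exist _ y Qy).
  pose fix s m : {x | Q m x} :=
    if m is k.+1 then projT1 (next k (s k)) else exist _ x0 Q0.
  exists (fun m => projT1 (s m)); split=> // m _; split; first exact: (projT2 (s m)).
  exact: (projT2 (next m (s m))).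
have [|s [s0 sP]] := IH (fun m => X m.+1) (fun m => d m.+1) x0
  (fun m => Q m.+1) (fun m => E m.+1) Q0; first by move=> m nm; apply: step.
exists (fun m => if m is k.+1 return X m then s k else d 0%N); split=> //.
by case=> // m; apply: sP.
Qed.

Section Complexes.
Variable A : nzRingType.

(** Projective resolutions with the augmentation forgotten. The cokernel of cd n is
thought of as the n-th syzygy. *)
Record complex := Complex {
  cobj :> nat -> lmodType A;
  cd : forall m, {linear cobj m.+1 -> cobj m};
  cproj : forall m, projective (cobj m);
  cexact : forall m, exact_at (cd m.+1) (cd m) }.

Arguments cd : clear implicits.
Arguments cproj : clear implicits.
Arguments cexact : clear implicits.

Definition maps (C C' : complex) := forall m, {linear C m -> C' m}.

Definition chain_map (C C' : complex) n (f : maps C C') : Prop :=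
  forall m, (n <= m)%N -> forall x, f m (cd C m x) = cd C' m (f m.+1 x).

(** As a map of m-th syzygies, f factors through a projective module: f - cd k kills
the boundaries. *)
Definition null (C C' : complex) m (f : C m -> C' m) : Prop :=
  exists k : {linear C m -> C' m.+1}, forall x, f (cd C m x) = cd C' m (k (cd C m x)).

Lemma cdd (C : complex) m x : cd C m (cd C m.+1 x) = 0.
Proof. by apply/(cexact _ _); exists x. Qed.

Section Pair.
Variables C C' : complex.
Implicit Types f g : maps C C'.

Lemma chain_map_le n m f : (n <= m)%N -> chain_map n f -> chain_map m f.
Proof. by move=> nm cf p mp; apply: cf; apply: leq_trans mp. Qed.

Lemma chain_map_extend n (f0 : {linear C n -> C' n}) :
  (forall x, exists y, f0 (cd C n x) = cd C' n y) ->
  exists f : maps C C', chain_map n f /\ f n = f0.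
Proof.
move=> h0.
have [|m _ x Qx|f [fn fP]] := @dependent_choice_nat (fun m => {linear C m -> C' m})
  (fun m => \0) n f0
  (fun m (g : {linear C m -> C' m}) => forall x, exists y, g (cd C m x) = cd C' m y)
  (fun m (g : {linear C m -> C' m}) (g' : {linear C m.+1 -> C' m.+1}) =>
     forall x, g (cd C m x) = cd C' m (g' x)) => //.
  have [|y yP] := @projective_lift _ _ _ _ (x \o cd C m) (cd C' m) (cproj C m.+1).
    by move=> w /=; have [y ->] := Qx w; exists y.
  exists y; split=> [w|w]; last by rewrite yP.
  have /(cexact _ _)[v <-] : cd C' m (y (cd C m.+1 w)) = 0 by rewrite yP /= cdd linear0.
  by exists v.
by exists f; split=> // m nm x; have [_ ->] := fP m nm.
Qed.

(** f - k d takes values in the cycles, hence lifts. *)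
Lemma null_step n f m (k : {linear C m -> C' m.+1}) : chain_map n f -> (n <= m)%N ->
  (forall x, f m (cd C m x) = cd C' m (k (cd C m x))) ->
  exists k' : {linear C m.+1 -> C' m.+2},
    forall x, f m.+1 x = cd C' m.+1 (k' x) + k (cd C m x).
Proof.
move=> cf nm kP.
have [|k' k'P] := @projective_lift _ _ _ _ (f m.+1 \- (k \o cd C m)) (cd C' m.+1) (cproj C m.+1).
  by move=> x; apply/(cexact _ _); rewrite /= linearB /= -cf // kP subrr.
by exists k' => x; rewrite k'P /= subrK.
Qed.

Lemma null_homotopy n f : chain_map n f -> null (f n) ->
  exists s : forall m, {linear C m -> C' m.+1}, forall m, (n <= m)%N -> forall x,
    f m.+1 x = cd C' m.+1 (s m.+1 x) + s m (cd C m x).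
Proof.
move=> cf [k kP].
have [||s [_ sP]] := @dependent_choice_nat (fun m => {linear C m -> C' m.+1})
  (fun m => \0) n k
  (fun m (k : {linear C m -> C' m.+1}) =>
     forall x, f m (cd C m x) = cd C' m (k (cd C m x)))
  (fun m (k : {linear C m -> C' m.+1}) (k' : {linear C m.+1 -> C' m.+2}) =>
     forall x, f m.+1 x = cd C' m.+1 (k' x) + k (cd C m x)) => //.
  move=> m nm {}k {}kP; have [k' k'P] := null_step cf nm kP.
  by exists k'; split=> // x; rewrite k'P cdd linear0 addr0.
by exists s => m nm x; have [_ ->] := sP m nm.
Qed.

Lemma null_le n m p f : chain_map n f -> (n <= m)%N -> (m <= p)%N ->
  null (f m) -> null (f p).
Proof.
move=> cf nm /subnK <- fm; elim: (p - m)%N => // j [k kP].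
have [|k' k'P] := null_step cf _ kP; first exact: leq_trans nm (leq_addl _ _).
by rewrite addSn; exists k' => x; rewrite k'P cdd linear0 addr0.
Qed.

Lemma nullD m (f g : C m -> C' m) : null f -> null g -> null (f \+ g).
Proof.
move=> [k kP] [l lP]; exists (k \+ l) => x /=.
by rewrite kP lP linearD.
Qed.

Lemma nullB m (f g : C m -> C' m) : null f -> null g -> null (f \- g).
Proof.
move=> [k kP] [l lP]; exists (k \- l) => x /=.
by rewrite kP lP linearB.
Qed.

Lemma null_ext m (f g : C m -> C' m) : f =1 g -> null f -> null g.
Proof. by move=> fg [k kP]; exists k => x; rewrite -fg. Qed.

Lemma null0 m (f : C m -> C' m) : (forall x, f x = 0) -> null f.
Proof. by move=> f0; exists (\0 : {linear _ -> _}) => x; rewrite f0 /= linear0. Qed.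

Lemma null_sum m (K : Type) (r : seq K) (F : K -> C m -> C' m) :
  (forall k, null (F k)) -> null (fun x => \sum_(k <- r) F k x).
Proof.
move=> nF; elim: r => [|k r IH]; first by apply: null0 => x; rewrite big_nil.
by apply: (null_ext _ (nullD (nF k) IH)) => x; rewrite big_cons.
Qed.

Lemma chain_mapB n f g : chain_map n f -> chain_map n g -> chain_map n (fun m => f m \- g m).
Proof. by move=> cf cg m nm x /=; rewrite cf // cg // linearB. Qed.

Lemma chain_map0 n : chain_map n (fun m => \0 : {linear C m -> C' m}).
Proof. by move=> m nm x /=; rewrite linear0. Qed.

(** Whether a later term is null depends only on the map of syzygies at the start,
since lifts to resolutions are unique up to homotopy. *)
Lemma null_congr n m f g : chain_map n f -> chain_map n g -> (n <= m)%N ->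
  null (f n \- g n) -> null (f m) -> null (g m).
Proof.
move=> cf cg nm nfg nf.
have nm' := null_le (chain_mapB cf cg) (leqnn n) nm nfg.
by apply: (null_ext _ (nullB nf nm')) => x /=; rewrite subKr.
Qed.

End Pair.

Lemma null_compl n m (C C' C'' : complex) (g : maps C' C'') (f : C m -> C' m) :
  chain_map n g -> (n <= m)%N -> null f -> null (g m \o f).
Proof.
move=> cg nm [k kP]; exists (g m.+1 \o k) => x /=.
by rewrite kP cg.
Qed.

Lemma null_compr n m (C C' C'' : complex) (g : C' m -> C'' m) (f : maps C C') :
  chain_map n f -> (n <= m)%N -> null g -> null (g \o f m).
Proof.
move=> cf nm [k kP]; exists (k \o f m) => x /=.
by rewrite cf // kP.
Qed.

Lemma chain_map_comp n (C C' C'' : complex) (g : maps C' C'') (f : maps C C') :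
  chain_map n g -> chain_map n f -> chain_map n (fun m => g m \o f m).
Proof. by move=> cg cf m nm x /=; rewrite cf // cg. Qed.

Lemma chain_map_id n (C : complex) : chain_map n (fun m => idfun : {linear C m -> C m}).
Proof. by []. Qed.

Section Power.
Variables (J : finType) (V : lmodType A).

Definition power_inj (j : J) (x : V) : J -> V := fun i => if i == j then x else 0.

Lemma power_inj_linear j : linear (power_inj j).
Proof.
move=> a u v; apply/funext => i.
have -> : (a *: power_inj j u + power_inj j v) i = a *: power_inj j u i + power_inj j v i by [].
by rewrite /power_inj; case: eqP => // _; rewrite scaler0 addr0.
Qed.
HB.instance Definition _ j := GRing.isLinear.Build A V (J -> V) *:%R (power_inj j) (power_inj_linear j).

Definition power_proj (j : J) (x : J -> V) : V := x j.
Lemma power_proj_linear j : linear (power_proj j). Proof. by []. Qed.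
HB.instance Definition _ j := GRing.isLinear.Build A (J -> V) V *:%R (power_proj j) (power_proj_linear j).

Lemma power_inj_sum x : x = \sum_j power_inj j (x j).
Proof.
apply/funext => i; rewrite fct_sumE (bigD1 i) //= /power_inj eqxx big1 ?addr0 // => j.
by rewrite eq_sym => /negPf->.
Qed.

Lemma projective_power : projective V -> projective (J -> V).
Proof.
move=> projV B D g f gsurj.
have /choice[h hP] : forall j, exists h : {linear V -> B}, forall x, g (h x) = f (power_inj j x).
  by move=> j; apply: (projV B D g (f \o power_inj j) gsurj).
pose H (x : J -> V) := \sum_j h j (x j).
have Hlin : linear H.
  move=> a u v; rewrite /H scaler_sumr -big_split; apply: eq_bigr => j _ /=.
  by rewrite linearP.
exists (mklinear Hlin) => x; rewrite /= /H linear_sum {2}(power_inj_sum x) linear_sum.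
by apply: eq_bigr => j _; rewrite hP.
Qed.

End Power.

Definition power_map (J : Type) (U V : lmodType A) (f : U -> V) (x : J -> U) : J -> V :=
  fun j => f (x j).

Lemma power_map_linear (J : Type) (U V : lmodType A) (f : {linear U -> V}) : linear (@power_map J _ _ f).
Proof. by move=> a u v; apply/funext => j; apply: linearP. Qed.
HB.instance Definition _ (J : Type) (U V : lmodType A) (f : {linear U -> V}) :=
  GRing.isLinear.Build A (J -> U) (J -> V) *:%R (@power_map J _ _ f) (@power_map_linear J _ _ f).

Lemma exact_power (J : Type) (U V W : lmodType A) (f : {linear U -> V}) (g : {linear V -> W}) :
  exact_at f g -> exact_at (@power_map J _ _ f) (@power_map J _ _ g).
Proof.
move=> fg y; split=> [gy|[x <-]].
  have /choice[x xP] : forall j, exists x, f x = y j.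
    by move=> j; apply/fg; have := congr1 (fun h => h j) gy.
  by exists x; apply/funext.
by apply/funext => j; apply/fg; exists (x j).
Qed.

Definition power (J : finType) (C : complex) : complex :=
  @Complex (fun m => (J -> C m) : lmodType A) (fun m => @power_map J _ _ (cd C m))
    (fun m => @projective_power J _ (cproj C m)) (fun m => @exact_power J _ _ _ _ _ (cexact C m)).

Definition tail (C : complex) : complex :=
  @Complex (fun m => C m.+1) (fun m => cd C m.+1) (fun m => cproj C m.+1)
    (fun m => cexact C m.+1).

Lemma exactN (U V W : lmodType A) (f : {linear U -> V}) (g : {linear V -> W}) :
  exact_at f g -> exact_at (\- f : {linear U -> V}) (\- g : {linear V -> W}).
Proof.
move=> fg y; split=> /= [/eqP|[x <-]].
  rewrite oppr_eq0 => /eqP/fg[x <-]; exists (- x).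
  by rewrite linearN opprK.
by rewrite linearN opprK; apply/fg; exists x.
Qed.

Definition neg (C : complex) : complex :=
  @Complex (fun m => C m) (fun m => \- cd C m) (fun m => cproj C m)
    (fun m => @exactN _ _ _ _ _ (cexact C m)).

End Complexes.
Arguments cd {A} c m.
Arguments cproj {A} c m.
Arguments cexact {A} c m.

(** * Composition series and stationary linear systems *)

Section Composition.
Variables (N : zmodType) (I : Type) (op : I -> N -> N).

Definition simple (Y X : set N) : Prop :=
  forall W, stable op W -> Y `<=` W -> W `<=` X -> W `<=` Y \/ X `<=` W.

(** Induction along a composition series, by splitting at intermediate subgroups. *)
Lemma composition_ind (P : set N -> set N -> Prop) :
  (forall X, stable op X -> P X X) ->
  (forall Y X, stable op Y -> stable op X -> Y `<=` X -> ~ X `<=` Y -> simple Y X -> P Y X) ->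
  (forall Y W X, stable op Y -> stable op W -> stable op X -> Y `<=` W -> W `<=` X ->
     P Y W -> P W X -> P Y X) ->
  forall n Y X, stable op Y -> stable op X -> Y `<=` X -> bounded op id Y X n -> P Y X.
Proof.
move=> Prefl Psimple Pcat; elim=> [|n IH] Y X sY sX YX b.
  have [XY|nXY] := pselect (X `<=` Y).
    by have -> : Y = X by [apply/seteqP]; apply: Prefl.
  have /b : chain op id Y X 1 X; last by [].
  apply: (chainS (W := Y)) => //; last exact: saturated_id.
  by apply: chain0 => //; apply: saturated_id.
have [XY|nXY] := pselect (X `<=` Y).
  by have -> : Y = X by [apply/seteqP]; apply: Prefl.
have [|nsimple] := pselect (simple Y X); first exact: Psimple.
have [W [sW YW WX nWY nXW]] : exists W, [/\ stable op W, Y `<=` W, W `<=` X,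
    ~ W `<=` Y & ~ X `<=` W].
  apply: contrapT => h; apply: nsimple => W sW YW WX.
  have [|nWY] := pselect (W `<=` Y); first by left.
  have [|nXW] := pselect (X `<=` W); first by right.
  by case: h; exists W.
apply: (Pcat Y W X) => //; apply: IH => // m Z cZ; rewrite -ltnS; apply: (b _ X).
  have [sZ _ ZW _] := chain_saturated cZ.
  apply: (chainS (W := Z)); last 1 first.
  - by move=> XZ; apply: nXW; apply: subset_trans ZW.
  - by apply: chain_forget cZ.
  - exact: saturated_id.
  - exact: subset_trans WX.
have c1 : chain op id Y W 1 W.
  apply: (chainS (W := Y)) => //; last exact: saturated_id.
  by apply: chain0 => //; apply: saturated_id.
have [sZ _ ZX _] := chain_saturated cZ.
apply: (chain_top (Z := Z)) => //; last exact: saturated_id.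
by apply: (chain_cat _ _ _ sX _ WX c1 cZ).
Qed.

(** The second clause is the way in which a composition series will be used: the set
S, which need not be a subgroup, is left for the first time at a simple step. *)
Definition composition_list (Y X : set N) (l : seq (set N * set N)) : Prop :=
  (forall i, (i < size l)%N -> let G := nth (Y, X) l i in
    [/\ stable op G.1, stable op G.2, G.1 `<=` G.2, simple G.1 G.2 &
        Y `<=` G.1 /\ G.2 `<=` X]) /\
  (forall S : set N, Y `<=` S -> ~ X `<=` S ->
    exists2 i, (i < size l)%N & let G := nth (Y, X) l i in G.1 `<=` S /\ ~ G.2 `<=` S).

Lemma exists_composition_list n Y X : stable op Y -> stable op X -> Y `<=` X ->
  bounded op id Y X n -> exists l, composition_list Y X l.
Proof.
move: n Y X; apply: composition_ind.
- by move=> X sX; exists [::]; split=> // S h /(_ h).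
- move=> Y X sY sX YX nXY YXs; exists [:: (Y, X)]; split.
    by case=> // _; split=> //=; split; exact: subset_refl.
  by move=> S YS nXS; exists 0%N.
- move=> Y W X sY sW sX YW WX [l [l1 l2]] [l' [l'1 l'2]]; exists (l ++ l'); split.
    move=> i; rewrite size_cat nth_cat => il.
    case: ltnP => [lt|ge].
      rewrite (set_nth_default (Y, W)) //; have [? ? ? ? [? ?]] := l1 _ lt.
      by split=> //; split=> //; apply: subset_trans WX.
    have lt : (i - size l < size l')%N by rewrite ltn_subLR.
    rewrite (set_nth_default (W, X)) //; have [? ? ? ? [? ?]] := l'1 _ lt.
    by split=> //; split=> //; apply: (subset_trans YW).
  move=> S YS nXS; have [WS|nWS] := pselect (W `<=` S).
    have [i lt h] := l'2 S WS nXS; exists (size l + i)%N.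
      by rewrite size_cat ltn_add2l.
    by rewrite nth_cat ltnNge leq_addr /= addKn (set_nth_default (W, X)).
  have [i lt h] := l2 S YS nWS; exists i.
    by rewrite size_cat; apply: leq_trans lt (leq_addr _ _).
  by rewrite nth_cat lt (set_nth_default (Y, W)).
Qed.

End Composition.

Section Counting.

Lemma rat_finite_length : finite_length (fun r x : rat => r * x) [set: rat].
Proof.
exists 1%N => m W cW; rewrite leqNgt; apply/negP => m1.
case: m W / cW m1 => // n V W; case=> // n' V' {}V cV' gV V'V nV'V gW VW nWV _.
apply: nWV => w _; have [sV _ _ _] := gV.
have [v Vv v0] : exists2 v, V v & v != 0.
  apply: contrapT => h; apply: nV'V => v Vv.
  have [->|v0] := eqVneq v 0; first by have [[]] := chain_saturated cV'.
  by case: h; exists v.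
by have [_ _ /(_ (w / v) v Vv)] := sV; rewrite divfK.
Qed.

(** The solutions (x, x') of all equations of index at least m form a subspace of a
finite dimensional rational vector space. It grows with m, so it is constant from
some index on. *)
Lemma counting_stationary s s' (js : nat -> seq 'I_s) (js' : nat -> seq 'I_s') b :
  exists2 n, (b <= n)%N & forall (x : 'I_s -> nat) (x' : 'I_s' -> nat),
    (exists r, forall m, (r <= m)%N ->
       (\sum_(j <- js m) x j = \sum_(j <- js' m) x' j)%N) ->
    (\sum_(j <- js n) x j = \sum_(j <- js' n) x' j)%N.
Proof.
pose T : finType := ('I_s + 'I_s')%type.
pose op (r : rat) (z : T -> rat) : T -> rat := fun t => r * z t.
pose lhs m (z : T -> rat) : rat := \sum_(j <- js m) z (inl j) - \sum_(j <- js' m) z (inr j).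
pose J m := [set z | forall n, (m <= n)%N -> lhs n z = 0].
have lhsB m x y : lhs m (x - y) = lhs m x - lhs m y.
  by rewrite /lhs !sumrB subrACA.
have lhsZ m r x : lhs m (op r x) = r * lhs m x.
  by rewrite /lhs mulrBr !mulr_sumr.
have sJ m : stable op (J m).
  split.
  - by move=> n _; rewrite /lhs !big1 ?subrr.
  - by move=> x y Jx Jy n mn; rewrite lhsB Jx // Jy // subrr.
  - by move=> r x Jx n mn; rewrite lhsZ Jx // mulr0.
have opB r x y : op r (x - y) = op r x - op r y.
  by apply/funext => t; rewrite /op /= mulrBr.
have fl : finite_length op [set: T -> rat].
  apply: (@finite_length_family _ rat _ op (fun r x => r * x) opB _ T (fun t z => z t) _ [set: rat]).
  - by move=> *; rewrite mulrBr.
  - by split.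
  - exact: rat_finite_length.
  - by [].
  - by [].
  - by [].
  - by move=> x _ x0; apply/funext.
have [||n nP] := finite_length_stationary fl sJ; first by [].
  by move=> m z Jz k mk; apply: Jz; apply: ltnW.
exists (maxn b n); first exact: leq_maxl.
move=> x x' [r rP].
have : J r (fun t => match t with inl j => (x j)%:R | inr j => (x' j)%:R end).
  move=> m rm; rewrite /lhs -!natr_sum; apply/eqP; rewrite subr_eq0; apply/eqP.
  by rewrite rP.
move=> /nP /(_ (maxn b n) (leq_maxr _ _)); rewrite /lhs -!natr_sum => /eqP.
by rewrite subr_eq0 eqr_nat => /eqP.
Qed.

End Counting.

(** * Maps of syzygies *)

Section Homs.
Variables (A : nzRingType) (I : Type) (z : I -> A).
Hypothesis zC : forall i a, z i * a = a * z i.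

(** The ground ring acts through central elements of A, and lengths are taken over it. *)
Definition scal (V : lmodType A) (i : I) (x : V) : V := z i *: x.

Lemma scalB (V : lmodType A) i (x y : V) : scal i (x - y) = scal i x - scal i y.
Proof. exact: scalerBr. Qed.

Lemma scal_linear (V : lmodType A) i : linear (@scal V i).
Proof. by move=> a u v; rewrite /scal scalerDr !scalerA zC. Qed.
HB.instance Definition _ (V : lmodType A) i :=
  GRing.isLinear.Build A V V *:%R (@scal V i) (@scal_linear V i).

Lemma linear_scal (U V : lmodType A) (f : {linear U -> V}) i x : f (scal i x) = scal i (f x).
Proof. exact: linearZ. Qed.

Lemma chain_map_scal (C : complex A) n i : chain_map n (fun m => @scal (C m) i : {linear _ -> _}).
Proof. by move=> m _ x /=; rewrite -linear_scal. Qed.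

(** Maps of n-th syzygies, through their representatives. *)
Definition homs (C C' : complex A) n : set (C n -> C' n) :=
  [set phi : C n -> C' n | exists2 f : maps C C', chain_map n f & phi = f n].

Definition eventually_null (C C' : complex A) n (f : maps C C') : Prop :=
  exists2 m, (n <= m)%N & null (f m).

(** The maps of n-th syzygies that vanish in the stabilisation of the stable category. *)
Definition nulls (C C' : complex A) n : set (C n -> C' n) :=
  [set phi : C n -> C' n | exists f : maps C C',
    [/\ chain_map n f, phi = f n & eventually_null n f]].

Section Pair.
Variables C C' : complex A.
Implicit Types f g : maps C C'.

Lemma eventually_nullB n f g : chain_map n f -> chain_map n g ->
  eventually_null n f -> eventually_null n g -> eventually_null n (fun m => f m \- g m).
Proof.
move=> cf cg [m nm nf] [p np ng]; exists (maxn m p); first by rewrite leq_max nm.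
by apply: nullB; [apply: (null_le cf nm) nf; exact: leq_maxl |
  apply: (null_le cg np) ng; exact: leq_maxr].
Qed.

Lemma eventually_null_eq n f g : chain_map n f -> chain_map n g ->
  f n =1 g n -> eventually_null n f -> eventually_null n g.
Proof.
move=> cf cg fg [m nm nf]; exists m => //; apply: (null_congr cf cg nm _ nf).
by apply: null0 => x /=; rewrite fg subrr.
Qed.

Lemma homs_stable n : stable (@scal _) (@homs C C' n).
Proof.
split.
- by exists (fun m => \0); [exact: chain_map0 | apply/funext].
- move=> _ _ [f cf ->] [g cg ->]; exists (fun m => f m \- g m); first exact: chain_mapB.
  exact/funext.
- move=> i _ [f cf ->]; exists (fun m => @scal (C' m) i \o f m) => //.
  by apply: chain_map_comp cf; apply: chain_map_scal.
Qed.

Lemma nulls_stable n : stable (@scal _) (@nulls C C' n).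
Proof.
split.
- exists (fun m => \0); split; [exact: chain_map0 | exact/funext |].
  by exists n => //; apply: null0.
- move=> _ _ [f [cf -> nf]] [g [cg -> ng]]; exists (fun m => f m \- g m).
  by split; [exact: chain_mapB | exact/funext | exact: eventually_nullB].
- move=> i _ [f [cf -> [m nm nf]]]; exists (fun m => @scal (C' m) i \o f m).
  have cz := @chain_map_scal C' n i.
  split=> //; first exact: chain_map_comp.
  by exists m => //; apply: (null_compl cz nm nf).
Qed.

Lemma nulls_homs n : @nulls C C' n `<=` @homs C C' n.
Proof. by move=> _ [f [cf -> _]]; exists f. Qed.

Lemma nullsP n f : chain_map n f -> nulls (f n : C n -> C' n) <-> eventually_null n f.
Proof.
move=> cf; split=> [[g [cg fg ng]]|nf]; last by exists f.
by apply: eventually_null_eq ng => // x; rewrite fg.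
Qed.

End Pair.

Lemma nulls_compl n (C C' C'' : complex A) (g : maps C' C'') (phi : C n -> C' n) :
  chain_map n g -> nulls phi -> nulls (g n \o phi).
Proof.
move=> cg [f [cf -> [m nm nf]]]; exists (fun m => g m \o f m); split=> //.
  exact: chain_map_comp.
by exists m => //; apply: (null_compl cg nm nf).
Qed.

Lemma nulls_compr n (C C' C'' : complex A) (g : maps C' C'') (phi : C n -> C' n) :
  chain_map n g -> eventually_null n g -> homs phi -> nulls (g n \o phi).
Proof.
move=> cg [m nm ng] [f cf ->]; exists (fun m => g m \o f m); split=> //.
  exact: chain_map_comp.
by exists m => //; apply: (null_compr cf nm ng).
Qed.

Lemma homs_comp n (C C' C'' : complex A) (g : maps C' C'') (phi : C n -> C' n) :
  chain_map n g -> homs phi -> homs (g n \o phi).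
Proof.
move=> cg [f cf ->]; exists (fun m => g m \o f m) => //.
exact: chain_map_comp.
Qed.

Definition power_inj_maps (J : finType) (C : complex A) j : maps C (power J C) :=
  fun m => (@power_inj A J (C m) j : {linear _ -> (J -> C m)}).

Definition power_proj_maps (J : finType) (C : complex A) j : maps (power J C) C :=
  fun m => (@power_proj A J (C m) j : {linear (J -> C m) -> _}).

Definition entry (J1 J2 : finType) (C C' : complex A) (f : maps (power J1 C) (power J2 C'))
    (j : J2) (i : J1) : maps C C' := fun m => power_proj_maps C' j m \o (f m \o power_inj_maps C i m).

Lemma chain_map_power_inj (J : finType) (C : complex A) n (j : J) :
  chain_map n (power_inj_maps C j).
Proof.
move=> m _ x /=; apply/funext => i; rewrite /power_map /power_inj.
by case: eqP => // _; rewrite linear0.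
Qed.

Lemma chain_map_power_proj (J : finType) (C : complex A) n (j : J) :
  chain_map n (power_proj_maps C j).
Proof. by []. Qed.

Lemma chain_map_entry n (J1 J2 : finType) (C C' : complex A)
    (f : maps (power J1 C) (power J2 C')) j i : chain_map n f -> chain_map n (entry f j i).
Proof.
move=> cf m nm x; rewrite /entry [LHS]/= [RHS]/=.
by rewrite (@chain_map_power_inj J1 C n i m nm) cf.
Qed.

Lemma entry_sum m (J1 J2 : finType) (C C' : complex A)
    (f : maps (power J1 C) (power J2 C')) x j : f m x j = \sum_i entry f j i m (x i).
Proof.
rewrite {1}(power_inj_sum x) linear_sum /= fct_sumE; exact: eq_bigr.
Qed.

Definition pairing (J : finType) (C C' : complex A) (f : J -> maps C C') :
    maps C (power J C') :=
  fun m => mklinear (U := C m) (V := (J -> C' m) : lmodType A) (f := fun x j => f j m x)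
    (fun a u v => funext (fun j => linearP (f j m) a u v)).

Lemma chain_map_pairing n (J : finType) (C C' : complex A) (f : J -> maps C C') :
  (forall j, chain_map n (f j)) -> chain_map n (pairing f).
Proof. by move=> cf m nm x; apply/funext => j /=; rewrite /power_map cf. Qed.

Lemma null_pairing m (J : finType) (C C' : complex A) (phi : C m -> (J -> C' m)) :
  (forall j, null (fun x => phi x j)) -> null (C' := power J C') phi.
Proof.
move=> /choice[k kP].
have klin : linear (fun x j => k j x) by move=> a u v; apply/funext => j; apply: linearP.
by exists (mklinear klin) => x; apply/funext => j /=; rewrite kP.
Qed.

Lemma null_power m (J1 J2 : finType) (C C' : complex A)
    (f : maps (power J1 C) (power J2 C')) n : chain_map n f -> (n <= m)%N ->
  (forall j i, null (entry f j i m)) -> null (f m).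
Proof.
move=> cf nm nf; apply: null_pairing => j.
have h : null (C := power J1 C) (C' := C') (m := m)
    (fun x => \sum_i (entry f j i m \o power_proj_maps C i m) x).
  apply: null_sum => i.
  exact: (null_compr (@chain_map_power_proj J1 C m i) (leqnn m) (nf j i)).
by apply: null_ext h => x; rewrite entry_sum.
Qed.

(** The maps that become null after m further syzygies increase with m, so finite
length makes them stationary. Since nullity can be tested on matrix entries, the
same bound serves all powers of C and C'. *)
Lemma null_stationary (C C' : complex A) n : finite_length (@scal _) (@homs C C' n) ->
  exists2 m, (n <= m)%N & forall (J1 J2 : finType) (f : maps (power J1 C) (power J2 C')),
    chain_map n f -> eventually_null n f -> null (f m).
Proof.
move=> fl.
pose J m := [set phi : C n -> C' n | exists f : maps C C',
  [/\ chain_map n f, phi = f n & null (f (m + n)%N)]].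
have sJ m : stable (@scal _) (J m).
  split.
  - by exists (fun m => \0); split; [exact: chain_map0 | exact/funext | exact: null0].
  - move=> _ _ [f [cf -> nf]] [g [cg -> ng]]; exists (fun m => f m \- g m).
    by split; [exact: chain_mapB | exact/funext | exact: nullB].
  - move=> i _ [f [cf -> nf]]; exists (fun m => @scal (C' m) i \o f m).
    have cz := @chain_map_scal C' n i.
    by split=> //; [exact: chain_map_comp | exact: (null_compl cz (leq_addl _ _) nf)].
have [||m mP] := finite_length_stationary fl sJ.
- by move=> m _ [f [cf -> _]]; exists f.
- move=> m _ [f [cf -> nf]]; exists f; split=> //.
  by apply: (null_le cf (leq_addl _ _) _ nf); rewrite addSn.
exists (m + n)%N; first exact: leq_addl.
move=> J1 J2 f cf [p np nf]; apply: (null_power cf); first exact: leq_addl.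
move=> j i; have ce := chain_map_entry j i cf.
have ne : null (entry f j i p).
  apply: (null_compl (@chain_map_power_proj J2 C' n j) np).
  exact: (null_compr (@chain_map_power_inj J1 C n i) np nf).
have [|g [cg eg ng]] := mP (p - n)%N (entry f j i n).
  by exists (entry f j i); split=> //; rewrite subnK.
apply: (null_congr cg ce _ _ ng); first exact: leq_addl.
by apply: null0 => x /=; rewrite -eg subrr.
Qed.
End Homs.

(** * Lengths of groups of maps of syzygies *)

Section LengthFormula.
Variables (A : nzRingType) (I : Type) (z : I -> A).
Hypothesis zC : forall i a, z i * a = a * z i.

Section Entrywise.
Variables (J : finType) (U V : lmodType A).

Definition entrywise (S : set (U -> V)) : set (U -> (J -> V)) :=
  [set y | forall j, S (fun x => y x j)].

Lemma entrywise_stable S : stable (@scal A I z _) S -> stable (@scal A I z _) (entrywise S).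
Proof.
move=> [S0 SB So]; split.
- by move=> j; apply: S0.
- by move=> x y Sx Sy j; apply: (SB _ _ (Sx j) (Sy j)).
- by move=> i x Sx j; apply: (So i _ (Sx j)).
Qed.

Lemma entrywise_sub S T : S `<=` T -> entrywise S `<=` entrywise T.
Proof. by move=> ST y Sy j; apply: ST. Qed.

Lemma entrywise_finite_length S : stable (@scal A I z _) S -> finite_length (@scal A I z _) S ->
  finite_length (@scal A I z _) (entrywise S).
Proof.
move=> sS fl; apply: (finite_length_family (p := fun j y x => y x j) _ _ _ fl) => //.
- exact: scalB.
- exact: scalB.
- exact: entrywise_stable.
- move=> y _ y0; apply/funext => x; apply/funext => j.
  exact: (congr1 (fun f => f x) (y0 j)).
Qed.

End Entrywise.

Variables (V : complex A) (b : nat).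

(** Lifts make these endomorphisms act on the maps into all later syzygies of V. *)
Definition endo := {f : maps V V | chain_map b f}.

Definition endo_op (U : lmodType A) n (g : endo) (phi : U -> V n) : U -> V n :=
  projT1 g n \o phi.

Lemma endo_opB (U : lmodType A) n g (x y : U -> V n) :
  endo_op g (x - y) = endo_op g x - endo_op g y.
Proof. by apply/funext => u; rewrite /endo_op /= linearB. Qed.

Lemma endo_stable_scalar (U : lmodType A) n (S : set (U -> V n)) :
  stable (@endo_op U n) S -> stable (@scal A I z _) S.
Proof.
move=> [S0 SB So]; split=> // i x Sx.
have e : scal z i x = endo_op (exist _ _ (@chain_map_scal _ _ _ zC V b i)) x by apply/funext.
by rewrite e; apply: So.
Qed.

Lemma entrywise_invariant (J : finType) (U : lmodType A) n (S : set (U -> V n))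
    (al : maps (power J V) (power J V)) : chain_map b al -> stable (@endo_op U n) S ->
  invariant (fun y => al n \o y) (entrywise (J := J) S).
Proof.
move=> cal sS y Sy j.
have -> : (fun x => (al n \o y) x j) =
    \sum_i endo_op (exist _ _ (chain_map_entry j i cal)) (fun x => y x i).
  by apply/funext => x; rewrite /= entry_sum fct_sumE.
by apply: (@stable_sum _ _ _ _ _ _ _ _ sS) => i _; case: (sS) => _ _; apply.
Qed.

Section Step.
Variables (U : complex A) (n : nat).
Hypothesis bn : (b <= n)%N.
Variables (B B' : set (U n -> V n)) (G G' : set (V b -> V b)) (a : U n -> V n).
Hypotheses (sB : stable (@endo_op _ n) B) (sB' : stable (@endo_op _ n) B').
Hypotheses (BB' : B `<=` B') (Bsimple : simple (@endo_op _ n) B B').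
Hypotheses (nB : @nulls A U V n `<=` B) (B'h : B' `<=` @homs A U V n).
Hypotheses (B'a : B' a).
Hypotheses (sG : stable (@endo_op _ b) G) (sG' : stable (@endo_op _ b) G').
Hypotheses (GG' : G `<=` G') (Gsimple : simple (@endo_op _ b) G G').
Hypothesis (G'h : G' `<=` @homs A V V b).
Hypothesis Ga : forall f : maps V V, chain_map b f -> G (f b) -> B (f n \o a).
Hypothesis nG'a : exists f : maps V V, [/\ chain_map b f, G' (f b) & ~ B (f n \o a)].

Let null_kill (f : maps V V) : chain_map b f -> (forall x, f b x = 0) -> B (f n \o a).
Proof.
move=> cf f0; apply: nB; apply: nulls_compr; last exact: B'h.
  exact: chain_map_le cf.
exists n => //; apply: (null_le cf (leqnn b)) => //.
exact: null0.
Qed.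

Let B'comp (f : maps V V) : chain_map b f -> B' (f n \o a).
Proof. by move=> cf; have [_ _ /(_ (exist _ f cf) a B'a)] := sB'. Qed.

(** The correspondence between G' and B' given by evaluation at a. It is only a
correspondence because a lift of an endomorphism from degree b to degree n is
unique only up to null maps. *)
Let rel (p : (V b -> V b) * (U n -> V n)) : Prop :=
  [/\ G' p.1, B' p.2 & exists f : maps V V,
     [/\ chain_map b f, f b = p.1 :> (V b -> V b) & B (p.2 - (f n \o a))]].

Let pair_op (g : endo) (p : (V b -> V b) * (U n -> V n)) := (endo_op g p.1, endo_op g p.2).

Let rel_stable : stable pair_op rel.
Proof.
have [G0 GB Go] := sG'; have [B0 BB Bo] := sB'; have [b0 bB bo] := sB; split.
- split=> //; exists (fun m => \0); split; [exact: chain_map0 | exact/funext|].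
  by rewrite (_ : _ - _ = 0) //; apply/funext => x /=; rewrite sub0r oppr0.
- move=> p q [Gp Bp [f [cf fp Bf]]] [Gq Bq [g [cg gq Bg]]]; split; [exact: GB | exact: BB|].
  exists (fun m => f m \- g m); split; first exact: chain_mapB.
    by apply/funext => x /=; rewrite fp gq.
  rewrite (_ : _ - _ = (p.2 - (f n \o a)) - (q.2 - (g n \o a))); first exact: bB.
  by rewrite subrACA.
- move=> [g cg] p [Gp Bp [f [cf fp Bf]]]; split; [exact: Go | exact: Bo|].
  exists (fun m => g m \o f m); split; first exact: chain_map_comp.
    by apply/funext => x; rewrite /= fp.
  rewrite (_ : _ - _ = endo_op (exist _ g cg) (p.2 - (f n \o a))); first exact: bo.
  by rewrite endo_opB.
Qed.

Let rel_GB p : rel p -> G p.1 <-> B p.2.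
Proof.
move=> [G'p B'p [f [cf fp Bf]]]; split=> [Gp|Bp].
  by apply: (stable_congr_r sB Bf); apply: Ga => //; rewrite fp.
pose K : set (V b -> V b) := [set g | G' g /\ exists f : maps V V,
   [/\ chain_map b f, f b = g :> (V b -> V b) & B (f n \o a)]].
have [G0 GB Go] := sG'; have [b0 bB bo] := sB.
have [||| |] := Gsimple (W := K).
- split.
  + split=> //; exists (fun m => \0); split; [exact: chain_map0 | exact/funext|].
    exact: (null_kill (@chain_map0 A V V b)).
  + move=> u v [Gu [g [cg gu Bg]]] [Gv [h [ch hv Bh]]]; split; first exact: GB.
    exists (fun m => g m \- h m); split; first exact: chain_mapB.
      by apply/funext => x /=; rewrite gu hv.
    exact: (bB _ _ Bg Bh).
  + move=> [g cg] u [Gu [h [ch hu Bh]]]; split; first exact: Go.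
    exists (fun m => g m \o h m); split; first exact: chain_map_comp.
      by apply/funext => x; rewrite /= hu.
    exact: (bo (exist _ g cg) _ Bh).
- move=> g Gg; split; first exact: GG'; have [h ch gh] := G'h (GG' Gg).
  by exists h; split=> //; apply: Ga => //; rewrite -gh.
- by move=> g [].
- apply; split=> //; exists f; split=> //.
  exact: (stable_congr_l sB Bf Bp).
- move=> G'K; have [g [cg G'g nBg]] := nG'a.
  have [_ [h [ch hg Bh]]] := G'K _ G'g; case: nBg.
  apply: (stable_congr_r sB _ Bh).
  apply: (null_kill (chain_mapB cg ch)) => x /=; rewrite hg subrr //.
Qed.

Let rel_surj h : B' h -> exists f : maps V V, [/\ chain_map b f, G' (f b) & B (h - (f n \o a))].
Proof.
have [G0 GB Go] := sG'; have [b0 bB bo] := sB; have [B0 BB Bo] := sB'.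
pose K : set (U n -> V n) := [set h | B' h /\ exists f : maps V V,
  [/\ chain_map b f, G' (f b) & B (h - (f n \o a))]].
have zero0 : (\0 : {linear V n -> V n}) \o a = 0 by [].
have [||| KB|B'K B'h'] := Bsimple (W := K).
- split.
  + split=> //; exists (fun m => \0); split; [exact: chain_map0 | exact: G0 |].
    by rewrite zero0 subrr.
  + move=> u v [Bu [g [cg Gg Bg]]] [Bv [k [ck Gk Bk]]]; split; first exact: BB.
    exists (fun m => g m \- k m); split; [exact: chain_mapB | exact: (GB _ _ Gg Gk) |].
    rewrite (_ : _ - _ = (u - (g n \o a)) - (v - (k n \o a))); first exact: bB.
    by rewrite subrACA.
  + move=> [g cg] u [Bu [k [ck Gk Bk]]]; split; first exact: Bo.
    exists (fun m => g m \o k m); split; first exact: chain_map_comp.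
      exact: (Go (exist _ g cg) _ Gk).
    rewrite (_ : _ - _ = endo_op (exist _ g cg) (u - (k n \o a))); first exact: bo.
    by rewrite endo_opB.
- move=> u Bu; split; first exact: BB'.
  exists (fun m => \0); split; [exact: chain_map0 | exact: G0 |].
  by rewrite zero0 subr0.
- by move=> u [].
- have [g [cg G'g nBg]] := nG'a; case: nBg; apply: KB; split; first exact: B'comp.
  by exists g; split=> //; rewrite subrr.
- by have [_] := B'K _ B'h'.
Qed.

(** Evaluation at a maps G into B but not G' into B, and both subquotients are simple
over the chain endomorphisms of V, so it identifies G' / G with B' / B. A length that
is twisted by a matrix al of such endomorphisms is therefore the same for both. *)
Lemma stable_length_simple (J : finType) (al : maps (power J V) (power J V)) r : chain_map b al ->
  stable_length (@scal A I z _) (fun y => al b \o y) (entrywise (J := J) G) (entrywise (J := J) G') r ->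
  stable_length (@scal A I z _) (fun y => al n \o y) (entrywise (J := J) B) (entrywise (J := J) B') r.
Proof.
move=> cal.
pose N := ((V b -> (J -> V b)) * (U n -> (J -> V n)))%type.
pose opN i (p : N) : N := (scal z i p.1, scal z i p.2).
pose thN (p : N) : N := (al b \o p.1, al n \o p.2).
pose X : set N := [set p | forall j, rel (fun x => p.1 x j, fun x => p.2 x j)].
have zB (W W' : lmodType A) i (x y : W -> W') : scal z i (x - y) = scal z i x - scal z i y.
  exact: scalB.
have alB m (W : lmodType A) (x y : W -> (J -> V m)) :
    al m \o (x - y) = (al m \o x) - (al m \o y).
  by apply/funext => w; rewrite /= linearB.
have [rel0 relB relo] := rel_stable.
have sX : stable opN X.
  split.
  - by move=> j; apply: rel0.
  - by move=> p q Xp Xq j; apply: (relB _ _ (Xp j) (Xq j)).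
  - move=> i p Xp j.
    have := relo (exist _ _ (@chain_map_scal _ _ _ zC V b i)) _ (Xp j).
    by congr rel; congr (_, _); apply/funext.
have iX : invariant thN X.
  move=> p Xp j.
  have -> : (fun x => (thN p).1 x j, fun x => (thN p).2 x j) =
     \sum_i pair_op (exist _ _ (chain_map_entry j i cal)) (fun x => p.1 x i, fun x => p.2 x i).
    rewrite [RHS]surjective_pairing (big_morph fst (fun _ _ => erefl) erefl).
    rewrite (big_morph snd (fun _ _ => erefl) erefl).
    by congr (_, _); apply/funext => x; rewrite /= entry_sum fct_sumE.
  by apply: (@stable_sum _ _ _ _ _ _ _ _ rel_stable) => i _; apply: relo.
have zG := endo_stable_scalar sG; have zG' := endo_stable_scalar sG'.
have zBs := endo_stable_scalar sB; have zB's := endo_stable_scalar sB'.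
have [[G0 _ _] [B0 _ _]] := (sG, sB).
have tG := @transfer_stable_length N _ I opN thN (@scal A I z _) (fun y => al b \o y) (zB _ _) (alB b _)
  fst X (entrywise (J := J) G) (entrywise (J := J) G') sX iX.
have tB := @transfer_stable_length N _ I opN thN (@scal A I z _) (fun y => al n \o y) (zB _ _) (alB n _)
  snd X (entrywise (J := J) B) (entrywise (J := J) B') sX iX.
rewrite -tG; first last.
- move=> y G'y.
  have /choice[f fP] : forall j, exists f : maps V V,
      chain_map b f /\ f b = (fun x => y x j) :> (V b -> V b).
    by move=> j; have [f cf ->] := G'h (G'y j); exists f.
  exists (y, fun x j => f j n (a x)) => /=; last by move=> j; rewrite subrr.
  move=> j; have [cf fy] := fP j; split; [exact: G'y | exact: (B'comp cf) |].
  by exists (f j); split=> //; rewrite subrr; case: sB.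
- by move=> p Xp j; have [] := Xp j.
- by move=> p Xp j; rewrite subrr.
- by move=> i p Xp j; rewrite subrr.
- by [].
- exact: entrywise_sub.
- exact: (entrywise_stable J zG').
- exact: (entrywise_invariant cal sG).
- exact: (entrywise_stable J zG).
rewrite -tB; first last.
- move=> y B'y.
  have /choice[f fP] : forall j, exists f : maps V V,
      [/\ chain_map b f, G' (f b) & B ((fun x => y x j) - (f n \o a))].
    by move=> j; apply: rel_surj; apply: B'y.
  exists (fun x j => f j b x, y) => /=; last by move=> j; rewrite subrr.
  move=> j; have [cf G'f Bf] := fP j; split; [exact: G'f | exact: B'y |].
  by exists (f j).
- by move=> p Xp j; have [] := Xp j.
- by move=> p Xp j; rewrite subrr.
- by move=> i p Xp j; rewrite subrr.
- by [].
- exact: entrywise_sub.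
- exact: (entrywise_stable J zB's).
- exact: (entrywise_invariant cal sB).
- exact: (entrywise_stable J zBs).
have -> // : [set p | X p /\ entrywise G p.1] = [set p | X p /\ entrywise B p.2].
by apply/seteqP; split=> p [Xp h]; split=> // j; apply/(rel_GB (Xp j)); apply: h.
Qed.

End Step.
End LengthFormula.

Section Core.
Variables (A : nzRingType) (I : Type) (z : I -> A).
Hypothesis zC : forall i a, z i * a = a * z i.

Lemma homs_endo_stable (U V : complex A) b n : (b <= n)%N ->
  stable (@endo_op A V b (U n) n) (@homs A U V n).
Proof.
move=> bn; have [h0 hB _] := homs_stable zC U V n; split=> // -[g cg] phi hphi.
by apply: homs_comp hphi; apply: chain_map_le cg.
Qed.

Lemma nulls_endo_stable (U V : complex A) b n : (b <= n)%N ->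
  stable (@endo_op A V b (U n) n) (@nulls A U V n).
Proof.
move=> bn; have [h0 hB _] := nulls_stable zC U V n; split=> // -[g cg] phi hphi.
by apply: nulls_compl hphi; apply: chain_map_le cg.
Qed.

Lemma homs_power (J : finType) (U V : complex A) n :
  @homs A U (power J V) n = entrywise (J := J) (@homs A U V n).
Proof.
apply/seteqP; split=> y.
  move=> [f cf ->] j; exists (fun m => power_proj_maps V j m \o f m) => //.
  exact: (chain_map_comp (@chain_map_power_proj A J V n j) cf).
move=> hy; have /choice[f fP] : forall j, exists f : maps U V,
    chain_map n f /\ (fun x => y x j) = f n.
  by move=> j; have [f cf fy] := hy j; exists f.
have cf j : chain_map n (f j) by have [] := fP j.
exists (pairing f); first exact: chain_map_pairing.
by apply/funext => x; apply/funext => j; have [_ /(congr1 (fun h => h x))] := fP j.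
Qed.

Lemma nulls_power (J : finType) (U V : complex A) n :
  @nulls A U (power J V) n = entrywise (J := J) (@nulls A U V n).
Proof.
apply/seteqP; split=> y.
  move=> [f [cf -> [m nm nf]]] j; exists (fun m => power_proj_maps V j m \o f m); split=> //.
    exact: (chain_map_comp (@chain_map_power_proj A J V n j) cf).
  by exists m => //; apply: (null_compl (@chain_map_power_proj A J V n j) nm nf).
move=> hy; have /choice[f fP] : forall j, exists f : maps U V,
  [/\ chain_map n f, (fun x => y x j) = f n & eventually_null n f] by exact: hy.
have cf j : chain_map n (f j) by have [] := fP j.
have /choice[m mP] : forall j, exists m, (n <= m)%N /\ null (f j m).
  by move=> j; have [_ _ [m]] := fP j; exists m.
exists (pairing f); split; first exact: chain_map_pairing.
  by apply/funext => x; apply/funext => j; have [_ /(congr1 (fun h => h x))] := fP j.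
exists (maxn n (\max_j m j)); first exact: leq_maxl.
apply: null_pairing => j; have [nm nf] := mP j.
by apply: (null_le (cf j) nm _ nf); rewrite leq_max leq_bigmax orbT.
Qed.

(** Each composition factor of the group of maps into the n-th syzygy is one of the
finitely many composition factors of the endomorphisms of the b-th syzygy. Their
number, in js, does not depend on J and al, and their twisted lengths, in x, do not
depend on n. *)
Lemma length_formula (U V : complex A) b :
  finite_length (@scal A I z _) (@homs A V V b) ->
  (forall n, finite_length (@scal A I z _) (@homs A U V n)) ->
  exists s (js : nat -> seq 'I_s), forall (J : finType) (al : maps (power J V) (power J V)),
    chain_map b al -> exists x : 'I_s -> nat, forall n, (b <= n)%N ->
      stable_length (@scal A I z _) (fun y => al n \o y) (@nulls A U (power J V) n) (@homs A U (power J V) n)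
        (\sum_(j <- js n) x j)%N.
Proof.
move=> flV flU.
have endoB n (W : lmodType A) g (x y : W -> V n) := @endo_opB A V b W n g x y.
have sN := nulls_endo_stable V V (leqnn b).
have sH := homs_endo_stable V V (leqnn b).
have [k bk] := finite_length_bounded id (endo_stable_scalar zC (b := b) (n := b) (U := V b))
  (let: And3 h _ _ := sN in h) flV.
have [l [l1 l2]] := exists_composition_list sN sH (@nulls_homs A V V b) bk.
pose G (i : 'I_(size l)) := nth (@nulls A V V b, @homs A V V b) l i.
have step n : (b <= n)%N -> exists js : seq 'I_(size l),
    forall (J : finType) (al : maps (power J V) (power J V)) (x : 'I_(size l) -> nat),
    chain_map b al ->
    (forall i, stable_length (@scal A I z _) (fun y => al b \o y) (entrywise (J := J) (G i).1)
       (entrywise (J := J) (G i).2) (x i)) ->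
    stable_length (@scal A I z _) (fun y => al n \o y) (entrywise (J := J) (@nulls A U V n))
       (entrywise (J := J) (@homs A U V n)) (\sum_(j <- js) x j)%N.
  move=> bn.
  pose P (Y X : set (U n -> V n)) := @nulls A U V n `<=` Y -> X `<=` @homs A U V n ->
    exists js : seq 'I_(size l),
    forall (J : finType) (al : maps (power J V) (power J V)) (x : 'I_(size l) -> nat),
    chain_map b al ->
    (forall i, stable_length (@scal A I z _) (fun y => al b \o y) (entrywise (J := J) (G i).1)
       (entrywise (J := J) (G i).2) (x i)) ->
    stable_length (@scal A I z _) (fun y => al n \o y) (entrywise (J := J) Y)
       (entrywise (J := J) X) (\sum_(j <- js) x j)%N.
  have sNn := nulls_endo_stable U V bn.
  have sHn := homs_endo_stable U V bn.
  have [kn bkn] := finite_length_bounded id (endo_stable_scalar zC (b := b) (n := n) (U := U n))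
    (let: And3 h _ _ := sNn in h) (flU n).
  apply: (@composition_ind _ _ _ P _ _ _ kn _ _ sNn sHn (@nulls_homs A U V n) bkn) => //.
  - move=> X sX _ _; exists [::] => J al x cal _; rewrite big_nil; apply: stable_length_refl.
      exact: (entrywise_stable J (endo_stable_scalar zC sX)).
    exact: (entrywise_invariant cal sX).
  - move=> Y X sY sX YX nXY YXs nY Xh.
    have [a [Xa nYa]] : exists a, X a /\ ~ Y a.
      by apply: contrapT => h; apply: nXY => a Xa; apply: contrapT => h'; apply: h; exists a.
    pose S : set (V b -> V b) := [set g | forall f : maps V V, chain_map b f ->
      f b = g :> (V b -> V b) -> Y (f n \o a)].
    have [||i lt [iS niS]] := l2 S.
    + move=> g [f [cf -> nf]] h ch hf; apply: nY; apply: nulls_compr; last exact: Xh.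
        exact: chain_map_le ch.
      have [m bm nm] := eventually_null_eq cf ch (fun x => esym (congr1 (fun u => u x) hf)) nf.
      exists (maxn n m); first exact: leq_maxl.
      by apply: (null_le ch bm _ nm); exact: leq_maxr.
    + move=> /(_ idfun) h; apply: nYa; apply: (h _ (fun m => idfun)) => //.
      by exists (fun m => idfun).
    exists [:: Ordinal lt] => J al x cal /(_ (Ordinal lt)); rewrite big_seq1 /G /=.
    have [sG sG' GG' Gs [nG G'h]] := l1 i lt.
    apply: (stable_length_simple zC bn sY sX YX YXs nY Xh Xa sG sG' GG' Gs G'h) => //.
      by move=> f cf /iS; apply.
    apply: contrapT => h; apply: niS => g Gg f cf fg; apply: contrapT => nYf.
    by apply: h; exists f; rewrite fg.
  - move=> Y W X sY sW sX YW WX PYW PWX nY Xh.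
    have [js jsP] := PYW nY (subset_trans WX Xh).
    have [js' js'P] := PWX (subset_trans nY YW) Xh.
    exists (js ++ js') => J al x cal xP; rewrite big_cat /=.
    apply: (stable_length_add _ _ _ _ _ _ _ _ _ (jsP J al x cal xP) (js'P J al x cal xP)).
    + exact: scalB.
    + by move=> u v; apply/funext => w; rewrite /= linearB.
    + by move=> j u; apply/funext => w; apply: linear_scal.
    + exact: (entrywise_stable J (endo_stable_scalar zC sW)).
    + exact: (entrywise_invariant cal sW).
    + exact: (entrywise_stable J (endo_stable_scalar zC sX)).
    + exact: (entrywise_invariant cal sX).
    + exact: entrywise_sub.
    + exact: entrywise_sub.
have /choice[js jsP] : forall n, exists js : seq 'I_(size l), (b <= n)%N ->
    forall (J : finType) (al : maps (power J V) (power J V)) (x : 'I_(size l) -> nat),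
    chain_map b al ->
    (forall i, stable_length (@scal A I z _) (fun y => al b \o y) (entrywise (J := J) (G i).1)
       (entrywise (J := J) (G i).2) (x i)) ->
    stable_length (@scal A I z _) (fun y => al n \o y) (entrywise (J := J) (@nulls A U V n))
       (entrywise (J := J) (@homs A U V n)) (\sum_(j <- js) x j)%N.
  move=> n; case: (leqP b n) => bn; last by exists [::].
  by have [js jsP] := step n bn; exists js.
exists (size l), js => J al cal.
have /choice[x xP] : forall i, exists x, stable_length (@scal A I z _) (fun y => al b \o y)
    (entrywise (J := J) (G i).1) (entrywise (J := J) (G i).2) x.
  move=> i; have [sG sG' GG' _ [nG G'h]] := l1 i (ltn_ord i).
  have [r br] := finite_length_bounded (op' := @scal A I z _) (fun y => al b \o y)
    (Y := entrywise (J := J) (G i).1) (X := entrywise (J := J) (G i).2)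
    (fun Z h => h) (let: And3 h _ _ := entrywise_stable J (endo_stable_scalar zC sG) in h)
    (finite_length_sub (entrywise_sub (J := J) G'h)
      (entrywise_finite_length J (endo_stable_scalar zC sH) flV)).
  apply: (bounded_stable_length _ _ _ br).
  - exact: (entrywise_stable J (endo_stable_scalar zC sG')).
  - exact: (entrywise_invariant cal sG').
  - exact: entrywise_sub.
by exists x => n bn; rewrite homs_power nulls_power; apply: jsP.
Qed.

Section Comparison.
Variables (U V V' : complex A) (b : nat) (J J' : finType).
Variables (al : maps (power J V) (power J V)) (be : maps (power J' V') (power J' V')).
Variable c : maps (power J' V') (power J V).
Hypotheses (cal : chain_map b al) (cbe : chain_map b be) (cc : chain_map b c).
Hypothesis alc : eventually_null b (fun m => (al m \o c m) \- (c m \o be m)).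
Hypothesis c_inj : forall n (h : maps U (power J' V')), (b <= n)%N -> chain_map n h ->
  eventually_null n (fun m => c m \o h m) -> eventually_null n (fun m => be m \o h m).

Variable n : nat.
Hypothesis bn : (b <= n)%N.
Let H := @homs A U (power J V) n.
Let Z := @nulls A U (power J V) n.
Let H' := @homs A U (power J' V') n.
Let Z' := @nulls A U (power J' V') n.
Let th (y : U n -> power J V n) : U n -> power J V n := al n \o y.
Let th' (y : U n -> power J' V' n) : U n -> power J' V' n := be n \o y.
Hypotheses (flH : finite_length (@scal A I z _) H) (flH' : finite_length (@scal A I z _) H').

Definition image_mod_nulls : set (U n -> power J V n) :=
  [set y | exists2 h, H' h & Z (y - (c n \o h))].
Let X := image_mod_nulls.

Let sH : stable (@scal A I z _) H. Proof. exact: homs_stable. Qed.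
Let sZ : stable (@scal A I z _) Z. Proof. exact: nulls_stable. Qed.
Let sH' : stable (@scal A I z _) H'. Proof. exact: homs_stable. Qed.
Let sZ' : stable (@scal A I z _) Z'. Proof. exact: nulls_stable. Qed.

Let iH : invariant th H.
Proof. by move=> y; apply: homs_comp; apply: chain_map_le cal. Qed.
Let iZ : invariant th Z.
Proof. by move=> y; apply: nulls_compl; apply: chain_map_le cal. Qed.
Let iH' : invariant th' H'.
Proof. by move=> y; apply: homs_comp; apply: chain_map_le cbe. Qed.
Let iZ' : invariant th' Z'.
Proof. by move=> y; apply: nulls_compl; apply: chain_map_le cbe. Qed.

Let thB x y : th (x - y) = th x - th y.
Proof. by apply/funext => w; rewrite /th /= linearB. Qed.
Let th'B x y : th' (x - y) = th' x - th' y.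
Proof. by apply/funext => w; rewrite /th' /= linearB. Qed.
Let th_scal i x : th (scal z i x) = scal z i (th x).
Proof. by apply/funext => w; apply: linear_scal. Qed.
Let th'_scal i x : th' (scal z i x) = scal z i (th' x).
Proof. by apply/funext => w; apply: linear_scal. Qed.

Let zB (W W' : lmodType A) i (x y : W -> W') : scal z i (x - y) = scal z i x - scal z i y.
Proof. exact: scalB. Qed.

Let c_th y : H' y -> Z (th (c n \o y) - (c n \o th' y)).
Proof.
have cg : chain_map b (fun m => (al m \o c m) \- (c m \o be m)).
  by apply: chain_mapB; apply: chain_map_comp.
move=> H'y; have [m bm nm] := alc.
have := nulls_compr (chain_map_le bn cg) _ H'y; apply.
by exists (maxn n m); [exact: leq_maxl | apply: (null_le cg bm _ nm); exact: leq_maxr].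
Qed.

Let cB (x y : U n -> power J' V' n) : c n \o (x - y) = (c n \o x) - (c n \o y).
Proof. by apply/funext => w; rewrite /= linearB. Qed.

Let c_scal i (x : U n -> power J' V' n) : c n \o scal z i x = scal z i (c n \o x).
Proof. by apply/funext => w; apply: linear_scal. Qed.

Let sX : stable (@scal A I z _) X.
Proof.
have [Z0 ZB Zo] := sZ; have [H0 HB Ho] := sH'; split.
- exists 0 => //; rewrite (_ : _ - _ = 0) //.
  by apply/funext => w; rewrite /= -[RHS](subrr 0) -{2}(linear0 (c n)).
- move=> x y [h Hh Zh] [k Hk Zk]; exists (h - k); first exact: HB.
  by rewrite cB subrACA; apply: ZB.
- move=> i x [h Hh Zh]; exists (scal z i h); first exact: Ho.
  by rewrite c_scal -zB; apply: Zo.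
Qed.

Let iX : invariant th X.
Proof.
move=> x [h Hh Zh]; exists (th' h); first exact: iH'.
rewrite -(subrKA (th (c n \o h))); apply: (stableD sZ); last exact: c_th.
by rewrite -thB; apply: iZ.
Qed.

Let ZX : Z `<=` X.
Proof.
have [H0 _ _] := sH'; move=> x Zx; exists 0 => //.
rewrite (_ : _ - _ = x) //; apply/funext => w.
by rewrite -[RHS]subr0 -(linear0 (c n)).
Qed.

Let XH : X `<=` H.
Proof.
move=> x [h Hh Zh]; apply: (stable_congr_r sH (nulls_homs Zh)).
by apply: homs_comp Hh; apply: chain_map_le cc.
Qed.

(** Modulo eventually null maps, the kernel of c on the maps into V' is killed by be,
so it has stable length zero. *)
Lemma stable_length_image r : stable_length (@scal A I z _) th' Z' H' r ->
  stable_length (@scal A I z _) th Z X r.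
Proof.
move=> rH'; pose Y := [set h | H' h /\ Z (c n \o h)].
have sY : stable (@scal A I z _) Y.
  have [Z0 ZB Zo] := sZ; have [H0 HB Ho] := sH'; split.
  - by split=> //; rewrite (_ : _ \o _ = 0) //; apply/funext => w /=; rewrite linear0.
  - by move=> x y [Hx Zx] [Hy Zy]; split; [exact: HB | rewrite cB; exact: ZB].
  - by move=> i x [Hx Zx]; split; [exact: Ho | rewrite c_scal; exact: Zo].
have iY : invariant th' Y.
  move=> x [Hx Zx]; split; first exact: iH'.
  by apply: (stable_congr_l sZ (c_th Hx)); apply: iZ.
have Z'Y : Z' `<=` Y.
  move=> x Zx; split; first exact: nulls_homs.
  by apply: nulls_compl Zx; apply: chain_map_le cc.
have YH' : Y `<=` H' by move=> x [].
have rY : stable_length (@scal A I z _) th' Z' Y 0.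
  apply/stable_length0P => // x [[h ch ->] Zh]; exists 1%N.
  have nh := c_inj bn ch (iffLR (nullsP (chain_map_comp (chain_map_le bn cc) ch)) Zh).
  exact: (iffRL (nullsP (chain_map_comp (chain_map_le bn cbe) ch)) nh).
have [q rq] : exists q, stable_length (@scal A I z _) th' Y H' q.
  have Y0 : Y 0 by case: sY.
  have [k bk] := finite_length_bounded (op' := @scal A I z _) th' (fun _ h => h) Y0 flH'.
  exact: (bounded_stable_length sH' iH' YH' bk).
have qr := stable_length_inj
  (stable_length_add (@zB _ _) th'B th'_scal sY iY sH' iH' YH' Z'Y rY rq) rH'.
rewrite add0n in qr; rewrite -qr.
apply/(@transfer_stable_length _ _ _ (@scal A I z _) th' (@scal A I z _) th (@zB _ _) thB
  (fun y => c n \o y) H' Z X sH') => //.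
- by move=> i x _; rewrite c_scal subrr; case: sZ.
- by move=> x Hx; exists x => //; rewrite subrr; case: sZ.
Qed.

Lemma stable_length_cokernel r r' : stable_length (@scal A I z _) th Z H r ->
  stable_length (@scal A I z _) th' Z' H' r' ->
  exists2 q, stable_length (@scal A I z _) th X H q & r = (r' + q)%N.
Proof.
move=> rH /stable_length_image rX.
have [q rq] : exists q, stable_length (@scal A I z _) th X H q.
  have X0 : X 0 by case: sX.
  have [k bk] := finite_length_bounded (op' := @scal A I z _) th (fun _ h => h) X0 flH.
  exact: (bounded_stable_length sH iH XH bk).
exists q => //; apply: stable_length_inj rH _.
exact: (stable_length_add (@zB _ _) thB th_scal sX iX sH iH XH ZX rX rq).
Qed.

Lemma stable_length_cokernel0 : stable_length (@scal A I z _) th X H 0 <->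
  forall y, H y -> exists N, X (iter N th y).
Proof. exact: stable_length0P. Qed.

End Comparison.

(** The degree from which the image of al lies in the image of c depends on the maps,
but n1 does not. In terms of stable lengths, injectivity gives an inequality in each
degree and surjectivity up to powers of al means equality. Equality in all high
degrees is a condition of the form treated in counting_stationary. *)
Lemma surjectivity_descent (U V V' : complex A) b :
  (forall n, finite_length (@scal A I z _) (@homs A V V n)) ->
  (forall n, finite_length (@scal A I z _) (@homs A V' V' n)) ->
  (forall n, finite_length (@scal A I z _) (@homs A U V n)) ->
  (forall n, finite_length (@scal A I z _) (@homs A U V' n)) ->
  exists2 n1, (b <= n1)%N & forall (J J' : finType)
    (al : maps (power J V) (power J V)) (be : maps (power J' V') (power J' V'))
    (c : maps (power J' V') (power J V)),
  chain_map b al -> chain_map b be -> chain_map b c ->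
  eventually_null b (fun m => (al m \o c m) \- (c m \o be m)) ->
  (forall n (h : maps U (power J' V')), (b <= n)%N -> chain_map n h ->
    eventually_null n (fun m => c m \o h m) -> eventually_null n (fun m => be m \o h m)) ->
  (exists r, forall n (y : maps U (power J V)), (r <= n)%N -> chain_map n y ->
    exists2 h : maps U (power J' V'), chain_map n h &
      null ((al n \o y n) \- (c n \o h n))) ->
  forall y : maps U (power J V), chain_map n1 y ->
    exists N (h : maps U (power J' V')), chain_map n1 h /\
      @nulls A U (power J V) n1 (fun x => iter N (al n1) (y n1 x) - c n1 (h n1 x)).
Proof.
move=> flV flV' flUV flUV'.
have [s [js jsP]] := length_formula (flV b) flUV.
have [s' [js' js'P]] := length_formula (flV' b) flUV'.
have [n1 bn1 n1P] := counting_stationary js js' b.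
exists n1 => // J J' al be c cal cbe cc alc c_inj [r c_surj].
have [x xP] := jsP J al cal; have [x' x'P] := js'P J' be cbe.
have fl n : finite_length (@scal A I z _) (@homs A U (power J V) n).
  rewrite homs_power; apply: entrywise_finite_length => //; exact: homs_stable.
have fl' n : finite_length (@scal A I z _) (@homs A U (power J' V') n).
  rewrite homs_power; apply: entrywise_finite_length => //; exact: homs_stable.
have e : (\sum_(j <- js n1) x j = \sum_(j <- js' n1) x' j)%N.
  apply: n1P; exists (maxn r b) => m; rewrite geq_max => /andP[rm bm].
  have [q + ->] := stable_length_cokernel cal cbe cc alc c_inj bm (fl m) (fl' m) (xP m bm) (x'P m bm).
  suff /stable_length_inj h : stable_length (@scal A I z _) (fun y => al m \o y)
    (image_mod_nulls (U := U) c (n := m))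
    (@homs A U (power J V) m) 0 by move=> /h <-; rewrite addn0.
  apply/(stable_length_cokernel0 U cal cbe cc alc bm) => _ [y cy ->]; exists 1%N.
  have [h ch nh] := c_surj m y rm cy; exists (h m); first by exists h.
  exists (fun p => (al p \o y p) \- (c p \o h p)); split.
  - apply: chain_mapB; apply: chain_map_comp => //; first exact: chain_map_le cal.
    exact: chain_map_le cc.
  - exact/funext.
  - by exists m.
have [q + eq] := stable_length_cokernel cal cbe cc alc c_inj bn1 (fl n1) (fl' n1) (xP n1 bn1) (x'P n1 bn1).
have -> : q = 0%N by apply: (@addnI (\sum_(j <- js' n1) x' j)); rewrite addn0 -eq e.
move=> /(stable_length_cokernel0 U cal cbe cc alc bn1) h y cy.
have [|N [_ [k ck ->] Zk]] := h (y n1); first by exists y.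
exists N, k; split=> //.
rewrite (_ : (fun x => _) = iter N (fun y => al n1 \o y) (y n1) - (c n1 \o k n1)) //.
apply/funext => w; rewrite -[RHS]/(iter N (fun y => al n1 \o y) (y n1) w - c n1 (k n1 w)).
congr (_ - _); elim: {Zk} N => //= N ->; done.
Qed.

End Core.

(** * Endomorphisms of a mapping cone *)

Section Cone.
Variable A : nzRingType.

Section Products.
Variables U V W : lmodType A.

Definition fst_linear : {linear (V * W)%type -> V} :=
  mklinear (U := (V * W)%type) (f := fst) (fun a u v => erefl).
Definition snd_linear : {linear (V * W)%type -> W} :=
  mklinear (U := (V * W)%type) (f := snd) (fun a u v => erefl).

Lemma pair_is_linear (f : {linear U -> V}) (g : {linear U -> W}) :
  linear (fun x => (f x, g x) : (V * W)%type).
Proof. by move=> a u v; rewrite !linearP. Qed.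
Definition pair_linear f g : {linear U -> (V * W)%type} := mklinear (@pair_is_linear f g).

End Products.
Arguments fst_linear {V W}.
Arguments snd_linear {V W}.

Lemma projective_prod (V W : lmodType A) : projective V -> projective W ->
  projective (V * W)%type.
Proof.
move=> projV projW B D g f gs.
have [h hP] := projV B D g (f \o pair_linear idfun \0) gs.
have [k kP] := projW B D g (f \o pair_linear \0 idfun) gs.
exists ((h \o fst_linear) \+ (k \o snd_linear)) => -[x y] /=.
rewrite linearD hP kP /= -linearD; congr (f _).
by rewrite [LHS]surjective_pairing /= addr0 add0r.
Qed.

Variables (C1 C2 : complex A) (c : maps (tail C2) C1).
Hypothesis cc : chain_map 0 c.

(** The resolution of the extension classified by c. As c commutes with the
differentials, that of C2 needs a sign, and the projection is a chain map to neg C2. *)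
Definition cone_d m : {linear (C1 m.+1 * C2 m.+1)%type -> (C1 m * C2 m)%type} :=
  pair_linear ((cd C1 m \o fst_linear) \+ (c m \o snd_linear)) (\- (cd C2 m \o snd_linear)).

Lemma cone_exact m : exact_at (cone_d m.+1) (cone_d m).
Proof.
move=> [x y]; split=> [[e1 e2]|[[x' y'] <-]].
  have /(cexact _ _)[y' e] : cd C2 m y = 0 by apply/eqP; rewrite -oppr_eq0; apply/eqP.
  have /(cexact _ _)[x' ex] : cd C1 m (x + c m.+1 y') = 0.
    by rewrite linearD -[X in _ + X](cc (m := m)) //= -/(cd C2 m.+1 y') e.
  exists (x', - y') => /=; congr (_, _) => /=.
    by rewrite linearN ex addrK.
  by rewrite linearN opprK.
rewrite /cone_d /=; congr (_, _) => /=.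
  rewrite linearD cdd add0r linearN (cc (m := m)) //= subrr //.
by rewrite linearN opprK cdd.
Qed.

Definition cone : complex A :=
  @Complex A (fun m => (C1 m * C2 m)%type : lmodType A) cone_d
   (fun m => projective_prod (cproj C1 m) (cproj C2 m)) cone_exact.

Definition cone_in : maps C1 cone := fun m => pair_linear idfun \0.
Definition cone_out : maps cone (neg C2) := fun m => snd_linear.

Lemma chain_map_cone_in n : chain_map n cone_in.
Proof.
move=> m _ x; rewrite /cone_in /=; congr (_, _) => /=.
  by rewrite linear0 addr0.
by rewrite linear0 oppr0.
Qed.

Lemma chain_map_cone_out n : chain_map n cone_out.
Proof. by []. Qed.

Lemma cone_split m (e : {linear cone m -> cone m}) x y :
  e (x, y) = e (x, 0) + e (0, y).
Proof.
rewrite -linearD; congr (e _).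
by rewrite [RHS]surjective_pairing /= addr0 add0r.
Qed.

End Cone.
Arguments fst_linear {A V W}.
Arguments snd_linear {A V W}.

Section Homotopies.
Variables (A : nzRingType) (C C' : complex A).
Variable s : forall m, {linear C m -> C' m.+1}.

(** In degree 0 the homotopy formula lacks a term, so the statements below start in
degree 1. *)
Definition homotopy_map : maps C C' := fun m =>
  match m return {linear C m -> C' m} with
  | 0 => \0
  | m.+1 => (cd C' m.+1 \o s m.+1) \+ (s m \o cd C m)
  end.

Lemma chain_map_homotopy n : chain_map n.+1 homotopy_map.
Proof.
case=> // m nm x /=.
by rewrite cdd linear0 addr0 linearD cdd add0r.
Qed.

Lemma null_homotopy_map m : null (homotopy_map m.+1).
Proof.
by exists (s m.+1) => x /=; rewrite cdd linear0 addr0.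
Qed.

End Homotopies.

Section Congruence.
Variables (A : nzRingType).

(** f and f', g and g' are equivalent modulo null maps, hence so are the composites. *)
Lemma null_comp_congr (C C' C'' : complex A) n m (f f' : maps C C') (g g' : maps C' C'') :
  chain_map n f -> chain_map n g' -> (n <= m)%N ->
  null (f m \- f' m) -> null (g m \- g' m) -> null ((g m \o f m) \- (g' m \o f' m)).
Proof.
move=> cf cg' nm nf ng.
have h1 := null_compr (g := g m \- g' m) cf nm ng.
have h2 := null_compl (f := f m \- f' m) cg' nm nf.
apply: (null_ext _ (nullD h1 h2)) => x /=.
by rewrite linearB /= subrKA.
Qed.

Fixpoint iter_maps (C : complex A) N (f : maps C C) : maps C C :=
  if N is N'.+1 then (fun m => f m \o iter_maps N' f m) else (fun m => idfun).

Lemma iter_mapsE (C : complex A) N (f : maps C C) m x : iter_maps N f m x = iter N (f m) x.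
Proof. by elim: N => //= N ->. Qed.

Lemma chain_map_iter (C : complex A) N (f : maps C C) n : chain_map n f ->
  chain_map n (iter_maps N f).
Proof. by move=> cf; elim: N => //= N IH; apply: chain_map_comp. Qed.

Lemma null_trans (C C' : complex A) m (f g h : {linear C m -> C' m}) :
  null (f \- g) -> null (g \- h) -> null (f \- h).
Proof. by move=> n1 n2; apply: (null_ext _ (nullD n1 n2)) => x /=; rewrite subrKA. Qed.

Lemma null_iter_congr (C : complex A) N (f f' : maps C C) n m :
  chain_map n f -> chain_map n f' -> (n <= m)%N -> null (f m \- f' m) ->
  null (iter_maps N f m \- iter_maps N f' m).
Proof.
move=> cf cf' nm nf; elim: N => [|N IH].
  by apply: null0 => x /=; rewrite subrr.
exact: (null_comp_congr (chain_map_iter N cf) cf' nm IH nf).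
Qed.

Lemma null_iter_idempotent (C : complex A) N (e : maps C C) n m :
  chain_map n e -> (n <= m)%N -> null ((e m \o e m) \- e m) ->
  null (iter_maps N.+1 e m \- e m).
Proof.
move=> ce nm ee; elim: N => [|N IH]; first by apply: null0 => x /=; rewrite subrr.
apply: (null_trans (g := e m \o e m)) => //.
apply: (@null_comp_congr C C C n m (iter_maps N.+1 e) e e e) => //.
  exact: chain_map_iter.
by apply: null0 => x /=; rewrite subrr.
Qed.

End Congruence.

Section Bound.
Variable A : nzRingType.

Lemma homs_linear (C C' : complex A) n phi : @homs A C C' n phi -> linear phi.
Proof. by move=> [f _ ->] a u v; rewrite linearP. Qed.

Section Triangular.
Variables (C1 C2 : complex A) (c : maps (tail C2) C1).
Hypothesis cc : chain_map 0 c.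
Let E := cone cc.
Variables (n : nat) (e : maps E E).
Hypotheses (ce : chain_map n e).
Hypothesis ne : null (C := C1) (C' := neg C2)
  (cone_out cc n \o (e n \o cone_in cc n)).

(** The homotopy contracting the component C1 -> C2, seen as a homotopy of the cone,
makes this component vanish when it is subtracted. *)
Lemma triangular : exists e' : maps E E, [/\ chain_map n.+1 e',
  forall m, (n < m)%N -> null (e' m \- e m) &
  forall m x, (n < m)%N -> (e' m (x, 0)).2 = 0].
Proof.
pose f : maps C1 (neg C2) := fun m => cone_out cc m \o (e m \o cone_in cc m).
have cf : chain_map n f.
  exact: (chain_map_comp (@chain_map_cone_out _ _ _ _ cc n)
    (chain_map_comp ce (@chain_map_cone_in _ _ _ _ cc n))).
have [s sP] := null_homotopy cf ne.
pose t m : {linear E m -> E m.+1} := pair_linear \0 (s m \o fst_linear).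
have ct : chain_map n.+1 (homotopy_map (C := E) (C' := E) t) by apply: chain_map_homotopy.
exists (fun m => e m \- homotopy_map (C := E) (C' := E) t m); split.
- by apply: chain_mapB ct; apply: chain_map_le ce.
- case=> // m nm; have := null_homotopy_map (C := E) (C' := E) t m.
  move=> /(nullB (null0 (fun x => erefl (0 : E m.+1)))); apply: null_ext => x /=.
  by rewrite sub0r addrAC subrr sub0r.
- case=> // m x nm /=; have := sP m nm x; rewrite /f /= => ->.
  by rewrite !linear0 !addr0 subrr.
Qed.

End Triangular.

Definition tail_maps (C C' : complex A) (f : maps C C') : maps (tail C) (tail C') :=
  fun m => f m.+1.

Lemma chain_map_tail (C C' : complex A) (f : maps C C') n : chain_map n f ->
  chain_map n (tail_maps f).
Proof. by move=> cf m nm x; apply: (cf m.+1); apply: leqW. Qed.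

Section TriangularComponents.
Variables (C1 C2 : complex A) (c : maps (tail C2) C1).
Hypothesis cc : chain_map 0 c.
Let E := cone cc.
Variables (b : nat) (e : maps E E).
Hypotheses (ce : chain_map b e).
Hypothesis e21 : forall m x, (b <= m)%N -> (e m (x, 0)).2 = 0.

Definition comp11 : maps C1 C1 := fun m => fst_linear \o (e m \o pair_linear idfun \0).
Definition comp22 : maps C2 C2 := fun m => snd_linear \o (e m \o pair_linear \0 idfun).
Definition comp12 m : {linear C2 m -> C1 m} := fst_linear \o (e m \o pair_linear \0 idfun).

Lemma comp_in m x : (b <= m)%N -> e m (x, 0) = (comp11 m x, 0).
Proof. by move=> bm; rewrite [LHS]surjective_pairing e21. Qed.

Lemma comp_apply m x y : (b <= m)%N ->
  e m (x, y) = (comp11 m x + comp12 m y, comp22 m y).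
Proof.
move=> bm; rewrite (@cone_split _ _ _ _ cc) comp_in // [e m (0, y)]surjective_pairing.
by rewrite [LHS]surjective_pairing /= add0r.
Qed.

Lemma comp_chain m x y : (b <= m)%N ->
  comp11 m (cd C1 m x + c m y) - comp12 m (cd C2 m y) =
    cd C1 m (comp11 m.+1 x + comp12 m.+1 y) + c m (comp22 m.+1 y) /\
  comp22 m (cd C2 m y) = cd C2 m (comp22 m.+1 y).
Proof.
move=> bm; have eD u v : cd E m (u, v) = (cd C1 m u + c m v, - cd C2 m v) by [].
have := ce bm (x, y); rewrite (comp_apply _ _ (leqW bm)) !eD comp_apply // => /pair_equal_spec[e1 e2].
split; first by rewrite -e1 linearN.
by apply: oppr_inj; rewrite -e2 linearN.
Qed.

Lemma chain_map_comp11 : chain_map b comp11.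
Proof.
move=> m bm x; have [+ _] := comp_chain x 0 bm.
by rewrite !linear0 !addr0.
Qed.

Lemma chain_map_comp22 : chain_map b comp22.
Proof. by move=> m bm y; have [_ ->] := comp_chain 0 y bm. Qed.

(** The remaining component C2 -> C1 of e is the homotopy. *)
Lemma comp_commute :
  null (C := tail C2) ((comp11 b \o c b) \- (c b \o tail_maps comp22 b)).
Proof.
exists (comp12 b.+1) => y; have [+ _] := comp_chain 0 (cd C2 b.+1 y) (leqnn b).
rewrite !linear0 !add0r cdd !linear0 addr0 => /= ->.
by rewrite addrK.
Qed.

Variable U : complex A.

(** If k contracts c h then (- k, h) maps boundaries to cycles of the cone. As e is null
in a high degree, so is e (- k, h), whose second component is comp22 h. *)
Lemma comp22_kernel n (h : maps U (tail C2)) :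
  (exists2 r, (b <= r)%N & forall m, (r <= m)%N -> null (e m)) ->
  (b <= n)%N -> chain_map n h -> eventually_null n (fun m => c m \o h m) ->
  eventually_null n (fun m => tail_maps comp22 m \o h m).
Proof.
move=> [r br er] bn ch [m nm nch]; pose p := maxn m r.
have np : (n <= p)%N by rewrite leq_max nm.
exists p => //.
have [k kP] : null (c p \o h p).
  apply: (null_le (f := fun m => c m \o h m) _ nm _ nch); last exact: leq_maxl.
  by apply: chain_map_comp ch; apply: chain_map_le cc.
have [l lP] : null (e p.+1) by apply: er; rewrite leqW // leq_maxr.
pose hh : {linear U p -> E p.+1} := pair_linear (\- k) (h p).
exists (\- (snd_linear \o (l \o hh))) => x.
have /(cexact E p)[w ew] : cd E p (hh (cd U p x)) = 0.
  rewrite /=; congr (_, _); last by rewrite ch // -/(cd C2 p.+1 _) cdd oppr0.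
  by rewrite /= linearN -kP addNr.
have := lP w; rewrite ew => /(congr1 snd).
have bp : (b <= p.+1)%N by rewrite leqW // (leq_trans br) // leq_maxr.
rewrite /hh [pair_linear _ _ _]/= comp_apply // => /= ->.
by rewrite linearN.
Qed.

(** The map e (y, 0) = (comp11 y, 0) is null, and the second component of a map
contracting it is h. *)
Lemma comp22_lift n (y : maps U C1) : (b <= n)%N -> null (e n) -> chain_map n y ->
  exists2 h : maps U (tail C2), chain_map n h & null ((comp11 n \o y n) \- (c n \o h n)).
Proof.
move=> bn [l lP] cy.
pose v : {linear U n -> E n.+1} := l \o (cone_in cc n \o y n).
have vP x : cd E n (v (cd U n x)) = (comp11 n (y n (cd U n x)), 0).
  rewrite /v /= cy //; have := @chain_map_cone_in _ _ _ _ cc n n (leqnn n) (y n.+1 x).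
  rewrite [cone_in _ _ _]/= => e1.
  by rewrite -comp_in // e1 lP.
have [|h [ch hn]] := @chain_map_extend A U (tail C2) n (snd_linear \o v).
  move=> x; have /(congr1 snd)/= := vP x => /eqP; rewrite oppr_eq0 => /eqP/(cexact _ _ _)[w <-].
  by exists w.
exists h => //; exists (fst_linear \o v) => x; rewrite hn.
have /(congr1 fst) /= <- := vP x.
by rewrite addrK.
Qed.

End TriangularComponents.
End Bound.

Section Factor.
Variables (A : nzRingType) (C1 C2 : complex A) (c : maps (tail C2) C1).
Hypothesis cc : chain_map 0 c.
Let E := cone cc.

Lemma pair0N m (y : C2 m) : (0, - y) = - ((0, y) : E m) :> E m.
Proof. by rewrite -[RHS]/(- 0, - y) oppr0. Qed.

Variables (n : nat) (e : maps E E).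
Hypotheses (ce : chain_map n e).
Hypothesis ne : null (C := C1) (C' := E) (e n \o cone_in cc n).

(** Subtract the contraction of e on C1, extended by zero to the cone. *)
Lemma factor_through_out : exists e' : maps E E, [/\ chain_map n.+1 e',
  forall m, (n < m)%N -> null (e' m \- e m) &
  forall m x y, (n < m)%N -> e' m (x, y) = e' m (0, y)].
Proof.
pose f : maps C1 E := fun m => e m \o cone_in cc m.
have cf : chain_map n f.
  exact: (chain_map_comp ce (@chain_map_cone_in _ _ _ _ cc n)).
have [s sP] := null_homotopy cf ne.
pose t m : {linear E m -> E m.+1} := s m \o fst_linear.
have ct : chain_map n.+1 (homotopy_map (C := E) (C' := E) t) by apply: chain_map_homotopy.
exists (fun m => e m \- homotopy_map (C := E) (C' := E) t m); split.
- by apply: chain_mapB ct; apply: chain_map_le ce.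
- case=> // m nm; have := null_homotopy_map (C := E) (C' := E) t m.
  move=> /(nullB (null0 (fun x => erefl (0 : E m.+1)))); apply: null_ext => x /=.
  by rewrite sub0r addrAC subrr sub0r.
- move=> m x y nm; rewrite (@cone_split _ _ _ _ cc) -[RHS]add0r; congr (_ + _).
  case: m nm x y => // m nm x _ /=; have := sP m nm x; rewrite /f /= => ->.
  by rewrite !linear0 !addr0 subrr.
Qed.

Hypothesis e_out : forall m x y, (n < m)%N -> e m (x, y) = e m (0, y).
Hypothesis ce1 : chain_map n.+1 e.

Definition out_comp : maps C2 C2 := fun m => snd_linear \o (e m \o pair_linear \0 idfun).

Lemma out_chain m y : (n < m)%N -> e m (0, cd C2 m y) = - cd E m (e m.+1 (0, y)).
Proof.
move=> nm; rewrite -(ce1 nm (0, y)).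
have -> : cd E m (0, y) = (cd C1 m 0 + c m y, - cd C2 m y) by [].
have -> : (0, cd C2 m y) = - ((0, - cd C2 m y) : E m) :> E m by rewrite -pair0N opprK.
by rewrite linearN [in RHS](e_out _ _ nm).
Qed.

Lemma chain_map_out_comp : chain_map n.+1 out_comp.
Proof.
by move=> m nm y; rewrite /out_comp /= out_chain //= opprK.
Qed.

(** If e = eps b with b the projection to C2, then (b eps) (b eps) = b e eps. *)
Lemma out_comp_square : (exists2 m, (n < m)%N & null (e m)) ->
  eventually_null n.+1 (fun m => out_comp m \o out_comp m).
Proof.
move=> [m nm [l lP]]; exists m => //.
pose in2 : {linear C2 m -> E m} := pair_linear \0 idfun.
exists (\- (snd_linear \o (l \o (e m \o in2)))) => y.
have e2 (p : E m) : e m (0, p.2) = e m p by case: p => u v; rewrite [RHS]e_out.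
rewrite /out_comp /in2 /= e2 out_chain // !linearN -/(cd E m _) lP !linearN /=.
by rewrite opprK.
Qed.

(** If e = eps b with b the projection to C2, then e e e = eps (b eps) (b eps) b. *)
Lemma out_comp_cube m : (n < m)%N -> null (C := C2) (C' := C2) (out_comp m \o out_comp m) ->
  null (e m \o (e m \o e m)).
Proof.
move=> nm [k kP].
pose in2 j : {linear C2 j -> E j} := pair_linear \0 idfun.
exists (\- (e m.+1 \o (in2 m.+1 \o (k \o snd_linear)))) => -[x y].
have e2 (p : E m) : e m p = e m (0, p.2) by case: p => u v; rewrite [LHS]e_out.
have := kP y; rewrite /out_comp /in2 /= => ky.
have e1 : e m (cd E m (x, y)) = - e m (0, cd C2 m y).
  by rewrite e2 -linearN -pair0N.
have e3 u : e m (e m (e m (0, u))) = e m (0, (e m (0, (e m (0, u)).2)).2).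
  by rewrite [LHS]e2 [in LHS](e2 (e m (0, u))).
rewrite -[LHS]/(e m (e m (e m (cd E m (x, y))))).
rewrite -[RHS]/(cd E m (- e m.+1 (0, k (- cd C2 m y)))).
rewrite e1 !linearN e3 ky out_chain // opprK.
by rewrite pair0N !linearN opprK.
Qed.

End Factor.

Section Copairing.
Variables (A : nzRingType) (J : finType) (C C' : complex A).

Lemma copairing_linear (f : J -> maps C C') m :
  linear (fun x : J -> C m => \sum_j f j m (x j)).
Proof.
move=> a u v; rewrite scaler_sumr -big_split; apply: eq_bigr => j _ /=.
exact: linearP.
Qed.
Definition copairing (f : J -> maps C C') : maps (power J C) C' := fun m =>
  mklinear (U := (J -> C m) : lmodType A) (@copairing_linear f m).

Lemma chain_map_copairing n (f : J -> maps C C') : (forall j, chain_map n (f j)) ->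
  chain_map n (copairing f).
Proof.
move=> cf m nm x; rewrite /= linear_sum; apply: eq_bigr => j _.
exact: cf.
Qed.

Lemma eventually_null_copairing n (f : J -> maps C C') : (forall j, chain_map n (f j)) ->
  (forall j, eventually_null n (f j)) -> eventually_null n (copairing f).
Proof.
move=> cf nf; have /choice[m mP] : forall j, exists m, (n <= m)%N /\ null (f j m).
  by move=> j; have [m] := nf j; exists m.
pose p := maxn n (\max_j m j); exists p; first exact: leq_maxl.
have h : null (C := power J C) (C' := C') (m := p)
    (fun x => \sum_j (f j p \o power_proj_maps C j p) x).
  apply: null_sum => j; have [nm nfj] := mP j.
  apply: (null_compr (@chain_map_power_proj A J C p j) (leqnn p)).
  by apply: (null_le (cf j) nm _ nfj); rewrite leq_max leq_bigmax orbT.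
exact: (null_ext _ h).
Qed.

End Copairing.

Lemma chain_map_neg_power (A : nzRingType) (J : finType) (C K : complex A) n
    (f : maps C (neg (power J K))) :
  chain_map n f -> chain_map (C' := power J (neg K)) n f.
Proof. by move=> cf m nm x; apply: (etrans (cf m nm x)); apply/funext. Qed.

Lemma null_neg_power (A : nzRingType) (J : finType) (C K : complex A) m
    (f : C m -> (J -> K m)) :
  null (C' := power J (neg K)) f <-> null (C' := neg (power J K)) f.
Proof.
by split=> -[k kP]; exists k => x; apply: (etrans (kP x)); apply/funext.
Qed.

(** * The bound for idempotents of cones *)

Section NullBound.
Variables (A : nzRingType) (I : Type) (z : I -> A).
Hypothesis zC : forall i a, z i * a = a * z i.
Variable K : complex A.
Hypothesis flK : forall m n,
  finite_length (@scal A I z _) [set phi : K m -> K n | linear phi].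

(** Applying al to al^N y = c h gives al^(N + 1) y = c (be h), modulo null maps. *)
Lemma lift_iterate (U C1 C2 : complex A) n (al : maps C1 C1) (be : maps C2 C2)
    (c : maps C2 C1) (y : maps U C1) (h : maps U C2) N N' :
  chain_map n al -> chain_map n be -> chain_map n c -> chain_map n y -> chain_map n h ->
  eventually_null n (fun m => (al m \o c m) \- (c m \o be m)) -> (N <= N')%N ->
  eventually_null n (fun m => (iter_maps N al m \o y m) \- (c m \o h m)) ->
  exists2 h' : maps U C2, chain_map n h' &
    eventually_null n (fun m => (iter_maps N' al m \o y m) \- (c m \o h' m)).
Proof.
move=> cal cbe cc cy ch alc /subnK <-; elim: (N' - N)%N => [|k IH] nh; first by exists h.
have [h' ch' [m nm nh']] := IH nh; have [p np nalc] := alc.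
exists (fun m => be m \o h' m); first exact: chain_map_comp.
pose q := maxn m p; have nq : (n <= q)%N by rewrite leq_max nm.
exists q => //.
have calc : chain_map n (fun m => (al m \o c m) \- (c m \o be m)).
  by apply: chain_mapB; apply: chain_map_comp.
have cit : chain_map n (fun m => (iter_maps (k + N) al m \o y m) \- (c m \o h' m)).
  by apply: chain_mapB; apply: chain_map_comp => //; apply: chain_map_iter.
have h1 := null_compr ch' nq (null_le calc np (leq_maxr m p) nalc).
have h2 := null_compl cal nq (null_le cit nm (leq_maxl m p) nh').
apply: (null_ext _ (nullD h2 h1)) => x /=.
by rewrite linearB /= subrKA.
Qed.

(** The degrees m0, n1, n2 and n3 are chosen in this order and depend on K only; the
degree from which e is null is arbitrary. *)
Theorem null_bound : exists n3, forall (J1 J2 : finType)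
    (c : maps (tail (power J2 K)) (power J1 K)) (cc : chain_map 0 c)
    (e : maps (cone cc) (cone cc)),
  chain_map 0 e -> null ((e 0%N \o e 0%N) \- e 0%N) ->
  (exists M, forall m, (M <= m)%N -> null (e m)) -> null (e n3).
Proof.
have flH (C C' : complex A) n :
    finite_length (@scal A I z _) [set phi : C n -> C' n | linear phi] ->
    finite_length (@scal A I z _) (@homs A C C' n).
  exact: finite_length_sub (@homs_linear A C C' n).
have [m0 _ m0P] := null_stationary zC (flH K (neg K) 0%N (flK 0 0)).
pose b := m0.+1.
have [n1 bn1 n1P] := @surjectivity_descent A I z zC K K (tail K) b
  (fun n => flH K K n (flK n n)) (fun n => flH (tail K) (tail K) n (flK n.+1 n.+1))
  (fun n => flH K K n (flK n n)) (fun n => flH K (tail K) n (flK n n.+1)).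
have [n2 n12 n2P] := null_stationary zC (flH K K n1 (flK n1 n1)).
have [n3 n23 n3P] := null_stationary zC (flH K K n2.+1 (flK n2.+1 n2.+1)).
exists n3 => J1 J2 c cc e ce ee [M eM].
(* The component C1 -> C2 of e is eventually null, because e is, hence null in degree m0. *)
have [e1 [ce1 e1e e1tri]] : exists e1 : maps (cone cc) (cone cc), [/\ chain_map b e1,
    forall m, (b <= m)%N -> null (e1 m \- e m) &
    forall m x, (b <= m)%N -> (e1 m (x, 0)).2 = 0].
  apply: triangular; first exact: chain_map_le ce.
  pose f : maps (power J1 K) (neg (power J2 K)) :=
    fun m => cone_out cc m \o (e m \o cone_in cc m).
  have cf : chain_map 0 f.
    exact: (chain_map_comp (@chain_map_cone_out _ _ _ _ cc 0)
      (chain_map_comp ce (@chain_map_cone_in _ _ _ _ cc 0))).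
  apply/null_neg_power; apply: (m0P J1 J2 f (chain_map_neg_power cf)).
  exists M => //; apply/null_neg_power.
  apply: (null_compl (@chain_map_cone_out _ _ _ _ cc 0) (leq0n M)).
  exact: (null_compr (@chain_map_cone_in _ _ _ _ cc 0) (leq0n M) (eM M (leqnn M))).
have e1null m : (maxn M b <= m)%N -> null (e1 m).
  rewrite geq_max => /andP[Mm bm].
  by apply: (null_ext _ (nullD (e1e m bm) (eM m Mm))) => x /=; rewrite subrK.
pose al := comp11 e1; pose be := tail_maps (comp22 e1).
have cal : chain_map b al := chain_map_comp11 ce1 e1tri.
have cbe : chain_map b be := chain_map_tail (chain_map_comp22 ce1 e1tri).
have ccb : chain_map b c := chain_map_le (leq0n b) cc.
have alc : eventually_null b (fun m => (al m \o c m) \- (c m \o be m)).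
  by exists b => //; apply: comp_commute.
have cc1 : chain_map n1 c := chain_map_le (leq0n n1) cc.
(* In degree n1 a power of al factors through c on each summand K of C1. *)
have main j : exists N (h : maps K (tail (power J2 K))), chain_map n1 h /\
    eventually_null n1 (fun m => (iter_maps N al m \o power_inj_maps K j m) \- (c m \o h m)).
  have [||N [h [ch nh]]] := n1P J1 J2 al be c cal cbe ccb alc _ _ (power_inj_maps K j)
    (@chain_map_power_inj A J1 K n1 j).
  - move=> n h bn ch.
    have er : exists2 r, (b <= r)%N & forall m, (r <= m)%N -> null (e1 m).
      by exists (maxn M b) => //; exact: leq_maxr.
    exact (@comp22_kernel A (power J1 K) (power J2 K) c cc b e1 e1tri K n h er bn ch).
  - exists (maxn M b) => n y Mn cy.
    have bn : (b <= n)%N by apply: leq_trans Mn; exact: leq_maxr.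
    exact (@comp22_lift A (power J1 K) (power J2 K) c cc b e1 e1tri K n y bn (e1null n Mn) cy).
  exists N, h; split=> //.
  pose F : maps K (power J1 K) := fun m => (iter_maps N al m \o power_inj_maps K j m) \- (c m \o h m).
  have cF : chain_map n1 F.
    apply: chain_mapB; last exact: (chain_map_comp cc1 ch).
    apply: (chain_map_comp (f := power_inj_maps K j) _ (@chain_map_power_inj A J1 K n1 j)).
    exact: (chain_map_iter _ (chain_map_le bn1 cal)).
  apply/(nullsP cF).
  rewrite (_ : (F n1 : _ -> _) = (fun x => iter N (al n1) (power_inj_maps K j n1 x) - c n1 (h n1 x))) //.
  by apply/funext => x; rewrite /F /= iter_mapsE.
have /choice[Nj /choice[hj hjP]] := main.
(* A common exponent N + 1; it is positive, so the corresponding power of e is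
equivalent to e. *)
pose N := (\max_j Nj j)%N.
have cal1 := chain_map_le bn1 cal; have cbe1 := chain_map_le bn1 cbe.
have alc1 : eventually_null n1 (fun m => (al m \o c m) \- (c m \o be m)).
  have [m bm nm] := alc; exists (maxn n1 m); first exact: leq_maxl.
  apply: (null_le (f := fun m => (al m \o c m) \- (c m \o be m)) _ bm _ nm); last exact: leq_maxr.
  by apply: chain_mapB; apply: chain_map_comp.
have /choice[g gP] : forall j, exists h : maps K (tail (power J2 K)), chain_map n1 h /\
    eventually_null n1 (fun m => (iter_maps N.+1 al m \o power_inj_maps K j m) \- (c m \o h m)).
  move=> j; have [ch nh] := hjP j.
  have lN : (Nj j <= N.+1)%N by rewrite leqW // leq_bigmax.
  have [h' ch' nh'] := lift_iterate cal1 cbe1 cc1 (@chain_map_power_inj A J1 K n1 j) ch alc1 lN nh.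
  by exists h'.
have cg j : chain_map n1 (g j) by have [] := gP j.
pose ga : maps (power J1 K) (tail (power J2 K)) := copairing g.
have cga : chain_map n1 ga by exact: chain_map_copairing.
pose de : maps (power J1 K) (power J1 K) := fun m => iter_maps N.+1 al m \- (c m \o ga m).
have cde : chain_map n1 de.
  by apply: chain_mapB; [exact: chain_map_iter | exact: chain_map_comp].
have nde : null (de n2).
  apply: (n2P J1 J1 de cde).
  pose F j : maps K (power J1 K) :=
    fun m => (iter_maps N.+1 al m \o power_inj_maps K j m) \- (c m \o g j m).
  have cF j : chain_map n1 (F j).
    apply: chain_mapB; last exact: chain_map_comp.
    apply: (chain_map_comp (f := power_inj_maps K j) _ (@chain_map_power_inj A J1 K n1 j)).
    exact: chain_map_iter.
  have [m nm nF] := eventually_null_copairing cF (fun j => proj2 (gP j)).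
  exists m => //; apply: (null_ext _ nF) => x.
  rewrite -[LHS]/(\sum_j (iter_maps N.+1 al m (power_inj j (x j)) - c m (g j m (x j)))) sumrB.
  rewrite -[RHS]/(iter_maps N.+1 al m x - c m (\sum_j g j m (x j))).
  by rewrite [X in iter_maps _ _ _ X](power_inj_sum x) !linear_sum.
have iter_e1 k m x : (b <= m)%N -> iter_maps k e1 m (x, 0) = (iter_maps k al m x, 0).
  by move=> bm; elim: k => //= k ->; exact: (comp_in e1tri _ bm).
have bn2 : (b <= n2)%N := leq_trans bn1 n12.
(* On C1 this power is c ga up to a null map, and c ga is null in the cone. *)
have ne1N : null (C := power J1 K) (C' := cone cc) (iter_maps N.+1 e1 n2 \o cone_in cc n2).
  have [k kP] := nde.
  exists (pair_linear k (ga n2)) => x.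
  have := kP x; rewrite /de /= => ek.
  rewrite -[LHS]/(iter_maps N.+1 e1 n2 (cd (power J1 K) n2 x, 0)) iter_e1 //.
  have e0 : cd (power J2 K) n2 (ga n2 (cd (power J1 K) n2 x)) = 0.
    by rewrite (cga _ n12); exact: cdd.
  congr (_, _); first by rewrite /= -ek /= subrK.
  by rewrite -[RHS]/(- cd (power J2 K) n2 (ga n2 (cd (power J1 K) n2 x))) e0 oppr0.
have ciN : chain_map n2 (iter_maps N.+1 e1).
  by apply: chain_map_iter; exact: chain_map_le ce1.
have [e2 [ce2 e2e e2out]] := factor_through_out ciN ne1N.
have e2e_m m : (n2 < m)%N -> null (e2 m \- e m).
  move=> nm; have bm : (b <= m)%N by apply: leq_trans bn2 (ltnW nm).
  apply: (null_trans (e2e m nm)).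
  apply: (null_trans (g := iter_maps N.+1 e m)).
    exact: (null_iter_congr _ ce1 (chain_map_le (leq0n b) ce) bm (e1e m bm)).
  apply: (null_iter_idempotent _ ce (leq0n m)).
  pose F : maps (cone cc) (cone cc) := fun m => (e m \o e m) \- e m.
  apply: (null_le (f := F) _ (leqnn 0) (leq0n m) ee).
  by apply: chain_mapB => //; exact: chain_map_comp.
(* e2 is equivalent to e, hence eventually null. *)
have sq : null (out_comp e2 n3 \o out_comp e2 n3).
  pose F : maps (power J2 K) (power J2 K) := fun m => out_comp e2 m \o out_comp e2 m.
  apply: (n3P J2 J2 F).
    by apply: chain_map_comp; exact: chain_map_out_comp.
  apply: out_comp_square => //; pose m := maxn n2.+1 M.
  have nm : (n2 < m)%N by exact: leq_maxl.
  exists m => //.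
  by apply: (null_ext _ (nullD (e2e_m m nm) (eM m (leq_maxr _ _)))) => x /=; rewrite subrK.
have cube := out_comp_cube e2out ce2 n23 sq.
have e2e3 := e2e_m n3 n23.
have i3 := null_iter_congr 3 ce2 (chain_map_le (leq0n _) ce) n23 e2e3.
have idem : null ((e n3 \o e n3) \- e n3).
  pose F : maps (cone cc) (cone cc) := fun m => (e m \o e m) \- e m.
  apply: (null_le (f := F) _ (leqnn 0) (leq0n n3) ee).
  by apply: chain_mapB => //; exact: chain_map_comp.
have i3' := null_trans i3 (null_iter_idempotent 2 ce (leq0n n3) idem).
by apply: (null_ext _ (nullB cube i3')) => x /=; rewrite subKr.
Qed.

End NullBound.

(** * Resolutions and projective dimension *)

Section Resolution.
Variables (A : nzRingType) (I : Type) (z : I -> A).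
Hypothesis zC : forall i a, z i * a = a * z i.
Hypothesis flA : finite_length (@scal A I z A^o) [set: A^o].

Lemma row_finite_length q : finite_length (@scal A I z 'rV[A]_q) [set: 'rV[A]_q].
Proof.
apply: (finite_length_family (p := fun (k : 'I_q) (x : 'rV[A]_q) => x 0 k : A^o) _ _ _ flA) => //.
- exact: scalB.
- exact: scalB.
- by move=> k x y _ _; rewrite !mxE.
- by move=> k i x _; rewrite mxE.
- by move=> x _ x0; apply/rowP => k; rewrite x0 mxE.
Qed.

Lemma row_linear_ext q (W : lmodType A) (f : {linear 'rV[A]_q -> W}) :
  (forall k, f (delta_mx 0 k) = 0) -> forall x, f x = 0.
Proof.
move=> f0 x; rewrite (row_sum_delta x) linear_sum big1 // => k _.
by rewrite linearZ /= f0 scaler0.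
Qed.

Lemma linear_finite_length q q' :
  finite_length (@scal A I z _) [set phi : 'rV[A]_q -> 'rV[A]_q' | linear phi].
Proof.
apply: (finite_length_family (p := fun (k : 'I_q) phi => phi (delta_mx 0 k)) _ _ _
  (row_finite_length q')) => //.
- exact: scalB.
- exact: scalB.
- split.
  + by move=> a u v; rewrite -[LHS]/0 -[RHS]/(a *: 0 + 0) scaler0 addr0.
  + move=> f g lf lg; exact: (linearP (mklinear lf \- mklinear lg)).
  + move=> i f lf; exact: (linearP (@scal A I z _ i \o mklinear lf)).
- move=> f lf f0; apply/funext; exact: (row_linear_ext (f := mklinear lf)).
Qed.

Lemma comb_linear q (W : lmodType A) (g : 'I_q -> W) :
  linear (fun x : 'rV[A]_q => \sum_i x 0 i *: g i).
Proof.
move=> a u v; rewrite scaler_sumr -big_split; apply: eq_bigr => i _ /=.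
by rewrite !mxE scalerDl scalerA.
Qed.
Definition comb q (W : lmodType A) (g : 'I_q -> W) : {linear 'rV[A]_q -> W} :=
  mklinear (comb_linear g).

Lemma comb_delta q (W : lmodType A) (g : 'I_q -> W) i : comb g (delta_mx 0 i) = g i.
Proof.
rewrite /= (bigD1 i) //= big1 => [|j ji]; rewrite mxE eqxx /=.
  by rewrite eqxx scale1r addr0.
by rewrite (negPf ji) scale0r.
Qed.

Lemma projective_row q : projective 'rV[A]_q.
Proof.
move=> B D g f gs; have /choice[h hP] : forall i, exists b, g b = f (delta_mx 0 i).
  by move=> i; apply: gs.
exists (comb h) => x; apply/eqP; rewrite -subr_eq0; apply/eqP.
apply: (row_linear_ext (f := (g \o comb h) \- f)) => i.
by rewrite -[LHS]/(g (comb h (delta_mx 0 i)) - f (delta_mx 0 i)) comb_delta hP subrr.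
Qed.

(** The kernel has finite length over the ground ring, so finitely many elements
generate it. *)
Lemma kernel_presentation q (W : lmodType A) (f : {linear 'rV[A]_q -> W}) :
  {q' & {d : {linear 'rV[A]_q' -> 'rV[A]_q} | exact_at d f}}.
Proof.
suff : exists q' (d : {linear 'rV[A]_q' -> 'rV[A]_q}), exact_at d f.
  by move=> /cid[q' /cid[d dP]]; exists q', d.
pose K : set 'rV[A]_q := [set x | f x = 0].
have sK : stable (@scal A I z _) K.
  split; first exact: linear0.
    by move=> x y Kx Ky; rewrite /K /= linearB Kx Ky subrr.
  by move=> i x Kx; rewrite /K /= linear_scal Kx linear0.
have [s sK' Ks] := finite_length_span sK
  (finite_length_sub (@subsetT _ K) (row_finite_length q)).
exists (size s), (comb (tnth (in_tuple s))) => y; split=> [fy|[x <-]]; last first.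
  rewrite linear_sum big1 // => i _; rewrite linearZ /=.
  by rewrite (sK' _ (mem_tnth i (in_tuple s))) scaler0.
have := Ks y fy (fun y => exists x, comb (tnth (in_tuple s)) x = y); apply.
  split; first by exists 0; rewrite linear0.
    by move=> _ _ [x <-] [x' <-]; exists (x - x'); rewrite linearB.
  by move=> i _ [x <-]; exists (scal z i x); rewrite linear_scal.
move=> w ws; have /tnthP[i ->] : w \in in_tuple s by [].
by exists (delta_mx 0 i); rewrite comb_delta.
Qed.

(** The ranks come first so that the source of each stage is the target of the next one
by conversion. *)
Definition stage := {p : nat * nat & {linear 'rV[A]_p.2 -> 'rV[A]_p.1}}.

Definition next_stage (s : stage) : stage :=
  let k := kernel_presentation (projT2 s) in
  existT (fun p : nat * nat => {linear 'rV[A]_p.2 -> 'rV[A]_p.1})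
    ((projT1 s).2, projT1 k) (projT1 (projT2 k)).

Lemma exists_resolution (T : lmodType A) : finitely_generated T ->
  exists (K : complex A) (pi : {linear K 0%N -> T}),
    [/\ forall m n, finite_length (@scal A I z _) [set phi : K m -> K n | linear phi],
        surjective pi & exact_at (cd K 0) pi].
Proof.
move=> [q [g gP]]; pose pi := comb g.
have [q' [d dpi]] := kernel_presentation pi.
pose s0 : stage := existT (fun p : nat * nat => {linear 'rV[A]_p.2 -> 'rV[A]_p.1}) (q, q') d.
pose s n := iter n next_stage s0.
pose K := @Complex A (fun n => 'rV[A]_(projT1 (s n)).1) (fun n => projT2 (s n))
  (fun n => @projective_row _) (fun n => projT2 (projT2 (kernel_presentation (projT2 (s n))))).
exists K, pi; split=> // [m n|x]; first exact: linear_finite_length.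
have [c ->] := gP x; exists (\row_i c i) => /=.
by apply: eq_bigr => i _; rewrite mxE.
Qed.

End Resolution.

Section Truncation.
Variable A : nzRingType.

Lemma projective_retract (P M : lmodType A) (s : {linear M -> P}) (r : {linear P -> M}) :
  projective P -> (forall x, r (s x) = x) -> projective M.
Proof.
move=> projP rs B D g f gs; have [h hP] := projP B D g (f \o r) gs.
by exists (h \o s) => x; rewrite /= hP /= rs.
Qed.

Lemma row0_zero (x : 'rV[A]_0) : x = 0.
Proof. by apply/rowP => -[]. Qed.

Lemma has_proj_resolution0 (M : lmodType A) : projective M -> has_proj_resolution M 0.
Proof.
move=> projM.
pose P i : lmodType A := if i is 0 then M else 'rV[A]_0.
pose d i : {linear P i.+1 -> P i} := \0.
pose e : {linear P 0 -> M} := idfun.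
have zeroP i (x y : P i.+1) : x = y by rewrite (row0_zero x) (row0_zero y).
exists P, d, e; split.
- by case=> [|i] //=; apply: projective_row.
- by case=> // i _ x; apply: zeroP.
- by move=> y; exists y.
- by move=> y; split=> [ey|[x <-]] //; exists 0; exact: esym ey.
- by move=> i y; split=> [_|[x <-]]; [exists 0; apply: zeroP | rewrite linear0].
Qed.

Lemma kernel_closed (P M : lmodType A) (eta : {linear P -> M}) :
  submod_closed [pred x | eta x == 0].
Proof.
split; first by rewrite inE linear0.
by move=> a u v; rewrite !inE linearP => /eqP-> /eqP->; rewrite scaler0 addr0.
Qed.

Definition kernel (P M : lmodType A) (eta : {linear P -> M}) : lmodType A :=
  submodule_type (Submodule (kernel_closed eta)).

Lemma has_proj_resolutionS (P M : lmodType A) (eta : {linear P -> M}) n :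
  projective P -> surjective eta -> has_proj_resolution (kernel eta) n ->
  has_proj_resolution M n.+1.
Proof.
move=> projP etas [Q [d [e [projQ Q0 es exe exd]]]].
have vlin : linear (val : kernel eta -> P) by move=> a u v; rewrite linearP.
pose incl : {linear kernel eta -> P} := mklinear vlin.
pose P' i : lmodType A := if i is j.+1 then Q j else P.
pose d' i : {linear P' i.+1 -> P' i} :=
  match i return {linear P' i.+1 -> P' i} with
  | 0 => incl \o e
  | j.+1 => d j
  end.
exists P', d', eta; split=> //.
- by case.
- by case.
- move=> y; split=> [/eqP ey|[x <-]]; last by have /eqP := valP (e x).
  by have [x ex] := es (exist _ y ey); exists x; rewrite /d' /= ex.
- case=> [|i]; last exact: exd.
  move=> y; split=> [ey|/exe ey]; last by rewrite -[LHS]/(incl (e y)) ey linear0.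
  by apply/exe; apply: val_inj.
Qed.

(** From d = d k d it follows that d k is an idempotent with image the boundaries, so
the n-th syzygy is a summand of P n. The induction replaces M by the kernel of its cover. *)
Lemma null_id_resolution (P : complex A) (M : lmodType A) (eta : {linear P 0%N -> M}) n :
  surjective eta -> exact_at (cd P 0) eta ->
  null (C := P) (C' := P) (m := n) idfun -> has_proj_resolution M n.
Proof.
elim: n P M eta => [|n IH] P M eta etas ex [k kP].
  apply: has_proj_resolution0.
  have /choice[s sP] : forall x, exists y, eta y = x by exact: etas.
  have well y : y - cd P 0 (k y) = s (eta y) - cd P 0 (k (s (eta y))).
    have /ex[x ex'] : eta (y - s (eta y)) = 0 by rewrite linearB sP subrr.
    apply/eqP; rewrite -subr_eq0 subrACA -!linearB -ex' -kP; apply/eqP; exact: subrr.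
  pose t x := s x - cd P 0 (k (s x)).
  have tlin : linear t.
    move=> a u v.
    have -> : t (a *: u + v) = t (eta (a *: s u + s v)) by rewrite linearP !sP.
    rewrite /t -well 2!linearP scalerBr opprD addrACA.
    by [].
  apply: (projective_retract (s := mklinear tlin) (r := eta) (cproj P 0)) => x.
  by rewrite /= /t linearB sP (_ : eta (cd _ _ _) = 0) ?subr0 //; apply/ex; eexists.
have dk x : cd P 0 x \in [pred x | eta x == 0] by rewrite inE; apply/eqP/ex; exists x.
pose eta' x : kernel eta := exist _ (cd P 0 x) (dk x).
have eta'lin : linear eta' by move=> a u v; apply: val_inj; apply: linearP.
apply: (has_proj_resolutionS (eta := eta) (cproj P 0) etas).
apply: (IH (tail P) _ (mklinear eta'lin)).
- move=> [y yk]; have /eqP/ex[x xy] := yk; exists x; exact: val_inj.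
- move=> y; split=> [/(congr1 val)/(cexact P 0)[x <-]|[x <-]]; first by exists x.
  by apply: val_inj; apply: cdd.
- by exists k.
Qed.

End Truncation.

(** * Summands of extensions of sums of copies of a module *)

Section ExtData.
Variables (A : nzRingType) (T : lmodType A).

(** For an extension 0 -> A1 -> V -> A2 -> 0 whose ends A1 and A2 are summands of powers
of T, this is what remains on V when A1 and A2 are forgotten: ext_in and ext_out are
the maps from and to the powers, ext_proj is the idempotent with image A2, and ext_sec
embeds the kernel A1 of ext_out into its power. In this form the data for the summands
of a direct sum can be assembled by formulas. *)
Record ext_data (V : lmodType A) := ExtData {
  ext_sub : finType;
  ext_quot : finType;
  ext_in : {linear (ext_sub -> T) -> V};
  ext_out : {linear V -> (ext_quot -> T)};
  ext_proj : {linear (ext_quot -> T) -> (ext_quot -> T)};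
  ext_sec : V -> (ext_sub -> T);
  ext_secK : forall v, ext_out v = 0 -> ext_in (ext_sec v) = v;
  ext_sec_linear : forall a u v, ext_out u = 0 -> ext_out v = 0 ->
    ext_sec (a *: u + v) = a *: ext_sec u + ext_sec v;
  ext_projK : forall v, ext_proj (ext_out v) = ext_out v;
  ext_proj_out : forall t, exists v, ext_out v = ext_proj t }.

Variables (K : complex A) (pi : {linear K 0%N -> T}).
Hypotheses (pi_surj : surjective pi) (pi_exact : exact_at (cd K 0) pi).

Lemma surjective_power_map (J : finType) : surjective (power_map pi : (J -> K 0%N) -> (J -> T)).
Proof.
move=> t; have /choice[x xP] : forall j, exists x, pi x = t j by move=> j; apply: pi_surj.
by exists x; apply/funext.
Qed.

Variable n3 : nat.
Hypothesis n3P : forall (J1 J2 : finType)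
    (c : maps (tail (power J2 K)) (power J1 K)) (cc : chain_map 0 c)
    (e : maps (cone cc) (cone cc)),
  chain_map 0 e -> null ((e 0%N \o e 0%N) \- e 0%N) ->
  (exists M, forall m, (M <= m)%N -> null (e m)) -> null (e n3).

(** By the horseshoe construction the cone E of c maps to V. As X is a retract of V, its
resolution P is a retract of E up to homotopy, through R and S, and the endomorphism
e = S R vanishes above the length of P. *)
Lemma retract_bound (V X : lmodType A) (D : ext_data V) (s : {linear X -> V})
    (r : {linear V -> X}) n :
  (forall x, r (s x) = x) -> has_proj_resolution X n -> has_proj_resolution X n3.
Proof.
move=> rs [P [d [eta [projP P0 etas exeta exd]]]].
pose PP := @Complex A P d projP exd.
case: D => J1 J2 phi psi q sigma sigmaK sigma_lin qK q_psi.
pose pi1 : {linear power J1 K 0%N -> (J1 -> T)} := @power_map A J1 _ _ pi.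
pose pi2 : {linear power J2 K 0%N -> (J2 -> T)} := @power_map A J2 _ _ pi.
have ex1 : exact_at (cd (power J1 K) 0) pi1 by exact: (@exact_power A J1 _ _ _ _ _ pi_exact).
have ex2 : exact_at (cd (power J2 K) 0) pi2 by exact: (@exact_power A J2 _ _ _ _ _ pi_exact).
have s1 : surjective pi1 by exact: surjective_power_map.
have s2 : surjective pi2 by exact: surjective_power_map.
have sigma0 : sigma 0 = 0.
  by have := sigma_lin (-1) 0 0 (linear0 _) (linear0 _); rewrite scaler0 addr0 scaleN1r addNr.
have sigmaD u v : psi u = 0 -> psi v = 0 -> sigma (u + v) = sigma u + sigma v.
  by move=> u0 v0; have := sigma_lin 1 u v u0 v0; rewrite !scale1r.
have sigmaN u : psi u = 0 -> sigma (- u) = - sigma u.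
  move=> u0; have := sigma_lin (-1) u 0 u0 (linear0 _).
  by rewrite !scaleN1r sigma0 !addr0.
have [lam lamP] : exists lam : {linear power J2 K 0%N -> V}, forall x, psi (lam x) = q (pi2 x).
  exact: (projective_lift (f := q \o pi2) (cproj (power J2 K) 0) (fun x => q_psi _)).
have psi_lam_d y : psi (lam (cd (power J2 K) 0 y)) = 0.
  by rewrite lamP (_ : pi2 _ = 0) ?linear0 //; apply/ex2; exists y.
have slin : linear (fun y => sigma (lam (cd (power J2 K) 0 y))).
  by move=> a u v; rewrite !linearP sigma_lin.
(* On boundaries lam takes values in the kernel of psi, which sigma carries to the
power of T covered by the first complex. *)
have [c0 c0P] : exists c0 : {linear tail (power J2 K) 0%N -> power J1 K 0%N},
    forall y, pi1 (c0 y) = sigma (lam (cd (power J2 K) 0 y)).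
  exact: (projective_lift (f := mklinear slin) (cproj (power J2 K) 1) (fun y => s1 _)).
have [|c [cc cc0]] := @chain_map_extend A (tail (power J2 K)) (power J1 K) 0 c0.
  move=> x; have /ex1[y <-] : pi1 (c0 (cd (tail (power J2 K)) 0 x)) = 0.
    by rewrite c0P (_ : cd _ _ (cd _ _ _) = 0) ?linear0 //; apply: cdd.
  by exists y.
pose E := cone cc.
pose eps : {linear E 0%N -> V} := (phi \o (pi1 \o fst_linear)) \+ (lam \o snd_linear).
have eps_d w : eps (cd E 0 w) = 0.
  case: w => x y.
  rewrite -[LHS]/(phi (pi1 (cd (power J1 K) 0 x + c 0%N y)) + lam (- cd (power J2 K) 0 y)).
  rewrite linearN linearD cc0 c0P (_ : pi1 _ = 0) ?add0r; last by apply/ex1; exists x.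
  by rewrite sigmaK // subrr.
(* R lifts r, and S lifts s: the second component of S0 covers psi s, and sigma
measures the error of its image under lam. *)
have [R0 R0P] : exists R0 : {linear E 0%N -> PP 0%N}, forall w, eta (R0 w) = r (eps w).
  exact: (projective_lift (f := r \o eps) (cproj E 0) (fun w => etas _)).
have [|Rm [cR R0e]] := @chain_map_extend A E PP 0 R0.
  move=> w; have /exeta[y <-] : eta (R0 (cd E 0 w)) = 0 by rewrite R0P eps_d linear0.
  by exists y.
have [y0 y0P] : exists y0 : {linear PP 0%N -> power J2 K 0%N},
    forall p, pi2 (y0 p) = psi (s (eta p)).
  exact: (projective_lift (f := psi \o (s \o eta)) (projP 0%N) (fun p => s2 _)).
have psi0 p : psi (s (eta p) - lam (y0 p)) = 0.
  by rewrite linearB lamP y0P qK subrr.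
have tlin : linear (fun p => sigma (s (eta p) - lam (y0 p))).
  move=> a u v; rewrite !linearP -sigma_lin //; congr sigma.
  by rewrite scalerN scalerBr addrACA.
have [x0 x0P] : exists x0 : {linear PP 0%N -> power J1 K 0%N},
    forall p, pi1 (x0 p) = sigma (s (eta p) - lam (y0 p)).
  exact: (projective_lift (f := mklinear tlin) (projP 0%N) (fun p => s1 _)).
pose S0 : {linear PP 0%N -> E 0%N} := pair_linear x0 y0.
have epsS p : eps (S0 p) = s (eta p).
  by rewrite -[LHS]/(phi (pi1 (x0 p)) + lam (y0 p)) x0P sigmaK // subrK.
have [|Sm [cS S0e]] := @chain_map_extend A PP E 0 S0.
  move=> p; pose dp := cd PP 0 p.
  have eta0 : eta dp = 0 by apply/exeta; exists p.
  have /ex2[y' ey'] : pi2 (y0 dp) = 0 by rewrite y0P eta0 !linear0.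
  have /ex1[x' ex'] : pi1 (x0 dp + c 0%N y') = 0.
    rewrite linearD x0P eta0 linear0 sub0r sigmaN; last by rewrite -ey'.
    by rewrite cc0 c0P ey' addNr.
  exists (x', - y'); rewrite -[LHS]/(x0 dp, y0 dp).
  rewrite -[RHS]/(cd (power J1 K) 0 x' + c 0%N (- y'), - cd (power J2 K) 0 (- y')).
  by rewrite !linearN opprK ex' addrK ey'.
pose RS : maps PP PP := fun m => Rm m \o Sm m.
have cRS : chain_map 0 RS := chain_map_comp cR cS.
have nRS : null (RS 0%N \- idfun).
  have [|k kP] := projective_lift (f := RS 0%N \- idfun) (g := d 0%N) (projP 0%N).
    move=> x; apply/exeta.
    by rewrite -[X in eta X]/(Rm 0%N (Sm 0%N x) - x) R0e S0e linearB R0P epsS rs subrr.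
  by exists k => x; rewrite -kP.
have nRSm m : null (RS m \- idfun).
  pose F : maps PP PP := fun m => RS m \- idfun.
  exact: (null_le (f := F) (chain_mapB cRS (@chain_map_id A 0 PP)) (leqnn 0) (leq0n m) nRS).
pose e : maps E E := fun m => Sm m \o Rm m.
have ce : chain_map 0 e := chain_map_comp cS cR.
have ee : null ((e 0%N \o e 0%N) \- e 0%N).
  have h := null_compl cS (leqnn 0) (null_compr cR (leqnn 0) nRS).
  by apply: (null_ext _ h) => x; rewrite /= linearB.
have en : exists M, forall m, (M <= m)%N -> null (e m).
  exists n.+1 => m nm; apply: null0 => x.
  by rewrite /e /= (P0 m nm (Rm m x)) linear0.
have ne3 := n3P ce ee en.
have h : null ((RS n3) \o (RS n3)).
  have := null_compl cR (leq0n n3) (null_compr cS (leq0n n3) ne3).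
  exact: null_ext.
have h' := null_comp_congr (f := RS) (f' := fun m => idfun) (g := RS) (g' := fun m => idfun)
  cRS (@chain_map_id A 0 PP) (leq0n n3) (nRSm n3) (nRSm n3).
apply: (null_id_resolution (P := PP) etas exeta).
by apply: (null_ext _ (nullB h h')) => x /=; rewrite subKr.
Qed.

End ExtData.
Arguments ext_sec {A T V} D _ _ : rename.

Section Layers.
Variables (L : nzRingType) (T : fgmod L).

Lemma add_class_retract (M : fgmod L) : add_class (fun N => N = T) M ->
  exists k (s : {linear M -> ('I_k -> T)}) (r : {linear ('I_k -> T) -> M}),
    forall x, r (s x) = x.
Proof.
move=> [k [V [B [VT [inj [proj [_ _ dec]]] [s [r rs]]]]]].
have eV : V = fun=> T by apply/funext.
subst V; exists k.
have slin : linear (fun x i => proj i (s x)) by move=> a u v; apply/funext => i; rewrite !linearP.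
have rlin : linear (fun t : 'I_k -> T => r (\sum_i inj i (t i))).
  move=> a u v; rewrite -linearP scaler_sumr -big_split; congr (r _).
  by apply: eq_bigr => i _ /=; rewrite -linearP.
by exists (mklinear slin), (mklinear rlin) => x /=; rewrite -dec.
Qed.

Lemma ext_data_short_exact (V A1 A2 : fgmod L) (f : {linear A1 -> V}) (g : {linear V -> A2}) :
  add_class (fun N => N = T) A1 -> add_class (fun N => N = T) A2 -> short_exact f g ->
  exists D : ext_data T V, True.
Proof.
move=> /add_class_retract[k [s1 [r1 rs1]]] /add_class_retract[l [s2 [r2 rs2]]] [f_inj fg g_surj].
have /choice[a aP] : forall v, exists a, g v = 0 -> f a = v.
  move=> v; have [/fg[a av]|nv] := pselect (g v = 0); first by exists a.
  by exists 0.
have g0 v : s2 (g v) = 0 -> g v = 0 by move=> e; rewrite -(rs2 (g v)) e linear0.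
unshelve eexists (@ExtData _ _ _ 'I_k 'I_l (f \o r1) (s2 \o g) (s2 \o r2)
  (fun v => s1 (a v)) _ _ _ _) => //.
- by move=> v /g0/aP e; rewrite /= rs1.
- move=> c u v /g0 gu /g0 gv; rewrite -linearP; congr (s1 _); apply: f_inj.
  by rewrite linearP !aP // linearP gu gv scaler0 addr0.
- by move=> v; rewrite /= rs2.
- by move=> t; have [v gv] := g_surj (r2 t); exists v; rewrite /= gv.
Qed.

Lemma ext_data_sum n (V : 'I_n -> fgmod L) (B : fgmod L) : direct_sum_of V B ->
  (forall i, ext_data T (V i)) -> exists D : ext_data T B, True.
Proof.
move=> [inj [proj [projK proj0 dec]]] D.
pose J1 : finType := {i : 'I_n & ext_sub (D i)}.
pose J2 : finType := {i : 'I_n & ext_quot (D i)}.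
pose in1 i j : J1 := existT (fun i : 'I_n => ext_sub (D i) : Type) i j.
pose in2 i j : J2 := existT (fun i : 'I_n => ext_quot (D i) : Type) i j.
have inlin : linear (fun t : J1 -> T => \sum_i inj i (ext_in (D i) (fun j => t (in1 i j)))).
  move=> a u v; rewrite scaler_sumr -big_split; apply: eq_bigr => i _ /=.
  by rewrite -!linearP.
have outlin : linear (fun (b : B) (j : J2) => ext_out (D (tag j)) (proj (tag j) b) (tagged j)).
  by move=> a u v; apply/funext => j; rewrite !linearP.
have qlin : linear (fun (t : J2 -> T) (j : J2) =>
    ext_proj (D (tag j)) (fun k => t (in2 (tag j) k)) (tagged j)).
  move=> a u v; apply/funext => j.
  by rewrite -[RHS]/((a *: ext_proj (D (tag j)) (fun k => u (in2 (tag j) k)) +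
    ext_proj (D (tag j)) (fun k => v (in2 (tag j) k))) (tagged j)) -linearP.
pose sec (b : B) (j : J1) : T := ext_sec (D (tag j)) (proj (tag j) b) (tagged j).
have out0 b : mklinear outlin b = 0 -> forall i, ext_out (D i) (proj i b) = 0.
  by move=> e i; apply/funext => j; have := congr1 (fun h => h (in2 i j)) e.
unshelve eexists (@ExtData _ _ _ J1 J2 (mklinear inlin) (mklinear outlin) (mklinear qlin) sec
  _ _ _ _) => //.
- move=> b /out0 b0; rewrite [RHS]dec; apply: eq_bigr => i _.
  by congr (inj i _); rewrite -[RHS](ext_secK (b0 i)).
- move=> c u v /out0 u0 /out0 v0; apply/funext => j.
  by rewrite /sec linearP ext_sec_linear.
- move=> b; apply/funext => j.
  exact: (congr1 (fun h => h (tagged j)) (@ext_projK _ _ _ (D (tag j)) (proj (tag j) b))).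
- move=> t; pose h i := cid (@ext_proj_out _ _ _ (D i) (fun k => t (in2 i k))).
  pose v i := projT1 (h i).
  have vP i : ext_out (D i) (v i) = ext_proj (D i) (fun k => t (in2 i k)).
    exact: projT2 (h i).
  exists (\sum_i inj i (v i)); apply/funext => j.
  rewrite -[RHS]/(ext_proj (D (tag j)) (fun k => t (in2 (tag j) k)) (tagged j)) -vP /=.
  congr (ext_out _ _ _); rewrite linear_sum (bigD1 (tag j)) //= projK big1 ?addr0 // => i ij.
  exact: proj0.
Qed.

Lemma ext_data_power k : exists D : ext_data T ('I_k -> T), True.
Proof.
unshelve eexists (@ExtData _ _ _ 'I_k 'I_0 idfun \0 \0 id _ _ _ _) => //.
by move=> t; exists 0.
Qed.

Lemma layer_ext_data n (M : fgmod L) : (n <= 1)%N -> layer T n.+1 M ->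
  exists (V : lmodType L^c) (D : ext_data T V) (s : {linear M -> V}) (r : {linear V -> M}),
    forall x, r (s x) = x.
Proof.
case: n => [_|[|//] _].
  move=> /add_class_retract[k [s [r rs]]]; have [D _] := ext_data_power k.
  by exists ('I_k -> T), D, s, r.
move=> [n [V [B [Vext dB [s [r rs]]]]]].
have D i : ext_data T (V i).
  apply: (projT1 (cid (_ : exists D : ext_data T (V i), True))).
  have [A1 [A2 [f [g [A1T A2T fg]]]]] := Vext i.
  exact: ext_data_short_exact fg.
have [DB _] := ext_data_sum dB D.
by exists B, DB, s, r.
Qed.

End Layers.

Section Numerics.

Lemma inf_nat_min (S : set nat) : S !=set0 ->
  exists2 n, S n & inf_nat S = (n%:Z)%:E.
Proof.
move=> [m Sm]; have ex : exists n, `[< S n >] by exists m; apply/asboolP.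
have [n /asboolP Sn nmin] := ex_minnP ex.
have mn : infimums [set (k%:Z)%:E | k in S] (n%:Z)%:E.
  split; last by move=> y; apply; exists n.
  by move=> _ [k Sk <-]; rewrite lee_fin lez_nat; apply: nmin; apply/asboolP.
exists n => //; rewrite /inf_nat /infimum; case: ifPn => [/eqP/seteqP[/(_ (m%:Z)%:E)h _]|_].
  by case: h; exists m.
case: xgetP => [y _ my|/(_ (n%:Z)%:E)]; last by case.
exact: (is_subset1_infimums my mn).
Qed.

Lemma inf_nat_le (S : set nat) n : S n -> (inf_nat S <= (n%:Z)%:E)%E.
Proof.
move=> Sn; have [|m Sm e] := @inf_nat_min S; first by exists n.
have ne : infimums [set (k%:Z)%:E | k in S] !=set0.
  move: e; rewrite /inf_nat /infimum; case: ifPn => // _; case: xgetP => // y _ iy _.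
  by exists y.
by apply: (le_infimum_Nmem _ ne); exists n.
Qed.

Lemma inf_nat_ltP (S : set nat) (x : \bar int) : (inf_nat S < +oo)%E -> S !=set0.
Proof.
apply: contraPP => /set0P/negP; rewrite negbK => /eqP ->.
by rewrite /inf_nat image_set0 /infimum eqxx ltxx.
Qed.

End Numerics.

Theorem corollary3p12 (R : comNzRingType) (L : algType R) :
  artin_algebra L -> (extdim L <= 1)%E -> (findim L < +oo)%E.
Proof.
move=> [artR fgL] ext1.
have [|m [T mT] em] := @inf_nat_min [set n | exists T : fgmod L, forall M, layer T n.+1 M].
  by apply: (@inf_nat_ltP _ 0); apply: le_lt_trans ext1 _; rewrite ltry.
have m1 : (m <= 1)%N by move: ext1; rewrite /extdim em lee_fin lez_nat.
(* R acts on right modules through its image in the centre of L. *)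
pose z (r : R) : L^c := (r%:A : L).
have zC r (a : L^c) : z r * a = a * z r.
  by rewrite -[LHS]/((a : L) * r%:A) -[RHS]/(r%:A * (a : L)) mulr_algr mulr_algl.
have flA : finite_length (@scal L^c R z (L^c)^o) [set: (L^c)^o].
  have [n [g gP]] := fgL.
  have scalE r (x : (L^c)^o) : scal z r x = r *: (x : L).
    by rewrite -[LHS]/((x : L) * r%:A) mulr_algr.
  have fl := @finite_length_combinations R ((L^c)^o) (@scal L^c R z (L^c)^o) _ _ _
    (map (g : 'I_n -> (L^c)^o) (index_enum 'I_n)) (artinian_finite_length artR).
  apply: finite_length_sub (fl _ _ _).
  - move=> x _; have [c ->] := gP x.
    rewrite (_ : \sum_i c i *: g i = \sum_(i <- index_enum 'I_n) scal z (c i) (g i : (L^c)^o)).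
      exact: combinations_sum.
    by apply: eq_bigr => i _; rewrite scalE.
  - by move=> r x y; rewrite scalB.
  - by move=> r s x; rewrite !scalE scalerBl.
  - by move=> r s x; rewrite !scalE scalerA.
have [K [pi [flK pi_surj pi_exact]]] := exists_resolution zC flA (fgmodP T).
have [n3 n3P] := null_bound zC flK.
suff le_n3 d : (exists M : fgmod L, (pd M < +oo)%E /\ d = pd M) -> (d <= (n3%:Z)%:E)%E.
  have lt_oo : ((n3%:Z)%:E < +oo :> \bar int)%E by rewrite ltry.
  rewrite /findim /supremum; case: ifPn => // _.
  case: xgetP => [y _ [_ ylub]|_] //.
  by apply: le_lt_trans lt_oo; apply: ylub => d /le_n3.
move=> [M [pdM ->]]; have [n Mn] := inf_nat_ltP 0 pdM.
apply: inf_nat_le.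
have [V [D [s [r rs]]]] := layer_ext_data m1 (mT M).
exact: (retract_bound pi_surj pi_exact n3P D rs Mn).
Qed.
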